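(* The space $R=\bigoplus_{n\ge0}H^0(\mathcal{L}_{-n},\overline{\nabla})$ carries a ring structure, induced by the multiplication isomorphisms $\mathcal{L}_{-n}\otimes_{\mathcal{A}(\mathbb{CP}^1_q)}\mathcal{L}_{-m}\simeq\mathcal{L}_{-n-m}$ (i.e. by the product of $\mathcal{A}(SU_q(2))$), and as a ring $R$ is isomorphic to the coordinate ring of the quantum plane $\mathbb{C}\langle a,c\rangle/(ac-qca)$.
   Context: Fix $0<q<1$. Let $\mathcal{A}(SU_q(2))$ be the unital complex $*$-algebra generated by $a,c$ subject to $ac=qca$, $ac^*=qc^*a$, $cc^*=c^*c$, $a^*a+c^*c=aa^*+q^2cc^*=1$. Let $U_q(su(2))$ be the Hopf algebra generated by $K,K^{-1},E,F$ with $KK^{-1}=K^{-1}K=1$, $KE=qEK$, $KF=q^{-1}FK$, $EF-FE=(K^2-K^{-2})/(q-q^{-1})$, coproduct $\Delta K=K\otimes K$, $\Delta E=E\otimes K+K^{-1}\otimes E$, $\Delta F=F\otimes K+K^{-1}\otimes F$, counit $\epsilon(K)=1,\epsilon(E)=\epsilon(F)=0$. It acts on $\mathcal{A}(SU_q(2))$ from the left making it a left module algebra, with $K\triangleright a=q^{-1/2}a$, $K\triangleright c=q^{-1/2}c$, $K\triangleright a^*=q^{1/2}a^*$, $K\triangleright c^*=q^{1/2}c^*$, $E\triangleright a=-qc^*$, $E\triangleright c=a^*$, $E\triangleright a^*=E\triangleright c^*=0$, $F\triangleright a=F\triangleright c=0$, $F\triangleright a^*=c$, $F\triangleright c^*=-q^{-1}a$.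 Put $X_-=q^{-1/2}FK$. For $k\in\mathbb{Z}$ let $\mathcal{L}_k=\{x\in\mathcal{A}(SU_q(2)):K\triangleright x=q^{k/2}x\}$, a bimodule over $\mathcal{A}(\mathbb{CP}^1_q):=\mathcal{L}_0$. Let $\Omega^1(SU_q(2))$ be the $\mathcal{A}(SU_q(2))$-bimodule that is free as a left module with basis $\omega_+,\omega_-,\omega_z$. The standard holomorphic structure on $\mathcal{L}_k$ is $\overline{\nabla}\phi:=(X_-\triangleright\phi)\,\omega_-$, and $H^0(\mathcal{L}_k,\overline{\nabla}):=\{\phi\in\mathcal{L}_k:\overline{\nabla}\phi=0\}$. *)

(* Defs.v *)
From HB Require Import structures.
From mathcomp Require Import all_boot all_order all_algebra complex.
From mathcomp Require Import reals.
Set Implicit Arguments. Unset Strict Implicit. Unset Printing Implicit Defensive.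
Import Order.TTheory GRing.Theory Num.Theory.
Local Open Scope ring_scope.

(* Free associative unital C-algebra on an alphabet T, presented by formal   *)
(* (finite) linear combinations of words.  Two formal sums denote the same   *)
(* element of the free algebra iff all their coefficients agree.             *)
Section FreeAlg.
Variables (C : pzRingType) (T : eqType).

Definition fsum := seq (C * seq T).

Definition fcoef (x : fsum) (w : seq T) : C := \sum_(p <- x | p.2 == w) p.1.

Definition fzero : fsum := [::].
Definition fone : fsum := [:: (1, [::])].
Definition fletter (g : T) : fsum := [:: (1, [:: g])].
Definition fadd (x y : fsum) : fsum := x ++ y.
Definition fscale (k : C) (x : fsum) : fsum := [seq (k * p.1, p.2) | p <- x].
Definition fmul (x y : fsum) : fsum :=
  [seq (p.1 * r.1, p.2 ++ r.2) | p <- x, r <- y].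
Definition fsub (x y : fsum) : fsum := fadd x (fscale (-1) y).

(* x lies in the two-sided ideal generated by the list of relators [rels]:
   x = sum_e  lambda_e * u_e * r_e * v_e  in the free algebra. *)
Definition in_ideal (rels : seq fsum) (x : fsum) : Prop :=
  exists t : seq (C * seq T * fsum * seq T),
    all (fun e => e.1.2 \in rels) t /\
    forall w, fcoef x w =
      \sum_(e <- t) e.1.1.1 * fcoef (fmul [:: (1, e.1.1.2)] (fmul e.1.2 [:: (1, e.2)])) w.

Definition qeq (rels : seq fsum) (x y : fsum) : Prop := in_ideal rels (fsub x y).
End FreeAlg.

(* A(SU_q(2)) : generators a, a^*, c, c^* ; relations of the *-algebra       *)
(* (the given ones together with their adjoints, which lie in the *-ideal).  *)
Inductive gen := Ga | Gas | Gc | Gcs.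

Definition gen_eqb (x y : gen) : bool :=
  match x, y with
  | Ga, Ga | Gas, Gas | Gc, Gc | Gcs, Gcs => true
  | _, _ => false end.
Lemma gen_eqP : Equality.axiom gen_eqb.
Proof. by case; case; constructor. Qed.
HB.instance Definition _ := hasDecEq.Build gen gen_eqP.

Section SUq2.
Variables (R : realType) (q : R).
Local Notation C := (R[i]).
Local Notation cq := (real_complex R q).

Definition suq2_rels : seq (fsum C gen) :=
  [:: (* a c = q c a *)        [:: (1, [:: Ga; Gc]); (- cq, [:: Gc; Ga])];
      (* a c^* = q c^* a *)    [:: (1, [:: Ga; Gcs]); (- cq, [:: Gcs; Ga])];
      (* c c^* = c^* c *)      [:: (1, [:: Gc; Gcs]); (-1, [:: Gcs; Gc])];
      (* c^* a^* = q a^* c^* (adjoint of a c = q c a) *)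
                               [:: (1, [:: Gcs; Gas]); (- cq, [:: Gas; Gcs])];
      (* c a^* = q a^* c (adjoint of a c^* = q c^* a) *)
                               [:: (1, [:: Gc; Gas]); (- cq, [:: Gas; Gc])];
      (* a^* a + c^* c = 1 *)  [:: (1, [:: Gas; Ga]); (1, [:: Gcs; Gc]); (-1, [::])];
                               [:: (1, [:: Ga; Gas]); (cq ^+ 2, [:: Gc; Gcs]); (-1, [::])]].

Definition eqA (x y : fsum C gen) : Prop := qeq suq2_rels x y.

Definition sq : C := real_complex R (Num.sqrt q).

(* K |> g = q^{wt g / 2} g *)
Definition wt (g : gen) : int :=
  match g with Ga | Gc => -1 | Gas | Gcs => 1 end.
Definition wtw (w : seq gen) : int := \sum_(g <- w) wt g.

(* K acts on words by the character (K is grouplike) *)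
Definition Kact (x : fsum C gen) : fsum C gen :=
  [seq (sq ^ wtw p.2 * p.1, p.2) | p <- x].

Definition Fgen (g : gen) : fsum C gen :=
  match g with
  | Ga | Gc => [::]
  | Gas => [:: (1, [:: Gc])]
  | Gcs => [:: (- cq^-1, [:: Ga])]
  end.

(* F on words, from the module-algebra property with
   Delta F = F (x) K + K^{-1} (x) F and eps(F) = 0:
   F |> (g w) = (F |> g)(K |> w) + (K^{-1} |> g)(F |> w). *)
Fixpoint Fword (w : seq gen) : fsum C gen :=
  match w with
  | [::] => [::]
  | g :: w' =>
      [seq (p.1 * sq ^ wtw w', p.2 ++ w') | p <- Fgen g]
      ++ [seq (sq ^ (- wt g) * p.1, g :: p.2) | p <- Fword w']
  end.

Definition Fact (x : fsum C gen) : fsum C gen :=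
  flatten [seq fscale p.1 (Fword p.2) | p <- x].

Definition Xminus (x : fsum C gen) : fsum C gen := fscale (sq^-1) (Fact (Kact x)).

Definition inL (k : int) (x : fsum C gen) : Prop := eqA (Kact x) (fscale (sq ^ k) x).

(* x in H^0(L_{-n}, nabla-bar) : x in L_{-n} and X_- |> x = 0 (the 1-form
   (X_- |> x) omega_- vanishes iff X_- |> x = 0, omega_- being part of a
   left basis of the free left module Omega^1). *)
Definition H0 (n : nat) (x : fsum C gen) : Prop :=
  inL (- (n%:Z)) x /\ eqA (Xminus x) (fzero C gen).

(* The graded space R = (+)_{n>=0} H^0(L_{-n}) : an element is a finite      *)
(* sequence of components, component n being (a representative of) an       *)
(* element of H^0(L_{-n}); components beyond the size are 0.                 *)
Definition Rcomp (r : seq (fsum C gen)) (n : nat) : fsum C gen := nth [::] r n.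
Definition isR (r : seq (fsum C gen)) : Prop := forall n, H0 n (Rcomp r n).
Definition eqR (r s : seq (fsum C gen)) : Prop :=
  forall n, eqA (Rcomp r n) (Rcomp s n).
Definition Radd (r s : seq (fsum C gen)) : seq (fsum C gen) :=
  mkseq (fun n => fadd (Rcomp r n) (Rcomp s n)) (maxn (size r) (size s)).
Definition Rmul (r s : seq (fsum C gen)) : seq (fsum C gen) :=
  mkseq (fun n => flatten [seq fmul (Rcomp r i) (Rcomp s (n - i)) | i <- iota 0 n.+1])
        (size r + size s).
Definition Rone : seq (fsum C gen) := [:: fone C gen].

End SUq2.

Inductive qgen := Qa | Qc.
Definition qgen_eqb (x y : qgen) : bool :=
  match x, y with Qa, Qa | Qc, Qc => true | _, _ => false end.
Lemma qgen_eqP : Equality.axiom qgen_eqb.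
Proof. by case; case; constructor. Qed.
HB.instance Definition _ := hasDecEq.Build qgen qgen_eqP.

Section QPlane.
Variables (R : realType) (q : R).
Local Notation C := (R[i]).
Definition qplane_rels : seq (fsum C qgen) :=
  [:: [:: (1, [:: Qa; Qc]); (- real_complex R q, [:: Qc; Qa])]].
Definition eqQ (x y : fsum C qgen) : Prop := qeq qplane_rels x y.
End QPlane.

(* Main.v *)
(* H^0(L_{-n}) is spanned by the monomials a^i c^j with i + j = n, and these
   satisfy only the relation of the quantum plane.
   A(SU_q(2)) embeds into the skew Laurent ring B[t, t^-1] over B = C[c, c^*],
   where t b = sigma(b) t and sigma scales c and c^* by q, through a |-> t and
   a^* |-> t^-1 (1 - q^2 c c^* ).  The embedding is injective because it sends
   the spanning family a^d c^l c^*^m, a^*^d c^l c^*^m to t^{+-d} P_d c^l c^*^m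
   with a nonzero polynomial P_d.  F extends to the Laurent ring, kills t and c,
   and acts on powers of c^* as a Jackson derivative, so that its kernel there
   consists of the combinations of t^d c^e with d in Z.  For d < 0 the element
   t^d c^e is not in the image of A(SU_q(2)), since c^e is not a multiple
   of P_d. *)
Require Import Defs.
From HB Require Import structures.
From mathcomp Require Import all_boot all_order all_algebra complex.
From mathcomp Require Import boolp reals.
From mathcomp Require Import ring zify.
Import Order.TTheory GRing.Theory Num.Theory.
Local Open Scope ring_scope.

Set Implicit Arguments.
Unset Strict Implicit.
Unset Printing Implicit Defensive.

(** * Presented algebras *)

Section LinearExtension.
Variables (C : comNzRingType) (T : eqType) (V : lmodType C).
Implicit Types (G : seq T -> V) (x y : fsum C T) (w : seq T).

(** Coefficients, classes in a quotient and components in the model are all instances of this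
    evaluation, so the lemmas below serve each of them. *)
Definition flin G x : V := \sum_(p <- x) p.1 *: G p.2.

Lemma flin_nil G : flin G [::] = 0.
Proof. by rewrite /flin big_nil. Qed.

Lemma flin_cons G p x : flin G (p :: x) = p.1 *: G p.2 + flin G x.
Proof. by rewrite /flin big_cons. Qed.

Lemma flin_add G x y : flin G (fadd x y) = flin G x + flin G y.
Proof. by rewrite /flin big_cat. Qed.

Lemma flin_scale G k x : flin G (fscale k x) = k *: flin G x.
Proof.
by rewrite /flin big_map scaler_sumr; apply: eq_bigr => p _; rewrite scalerA.
Qed.

Lemma flin_sub G x y : flin G (fsub x y) = flin G x - flin G y.
Proof. by rewrite flin_add flin_scale scaleN1r. Qed.

Lemma flin_flatten G (s : seq (fsum C T)) :
  flin G (flatten s) = \sum_(x <- s) flin G x.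
Proof.
elim: s => [|x s IH]; first by rewrite big_nil flin_nil.
by rewrite big_cons /= -IH -flin_add.
Qed.

Lemma flin_mul G x y :
  flin G (fmul x y) = \sum_(p <- x) p.1 *: flin (fun w => G (p.2 ++ w)) y.
Proof.
rewrite /flin big_allpairs_dep; apply: eq_bigr => p _.
by rewrite scaler_sumr; apply: eq_bigr => r _ /=; rewrite scalerA.
Qed.

Lemma flin_sandwich G u x v :
  flin G (fmul [:: (1, u)] (fmul x [:: (1, v)])) =
  flin (fun w => G (u ++ w ++ v)) x.
Proof.
rewrite flin_mul big_seq1 scale1r flin_mul; apply: eq_bigr => p _.
by rewrite flin_cons flin_nil addr0 scale1r.
Qed.

Lemma eq_flin G G' x : G =1 G' -> flin G x = flin G' x.
Proof. by move=> e; apply: eq_bigr => p _; rewrite e. Qed.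

Lemma flin_fcoef G x (S : seq (seq T)) :
  uniq S -> {subset [seq p.2 | p <- x] <= S} ->
  flin G x = \sum_(w <- S) fcoef x w *: G w.
Proof.
move=> uS sub.
under eq_bigr do rewrite /fcoef big_mkcond scaler_suml.
rewrite exchange_big /flin /= [LHS]big_seq [RHS]big_seq; apply: eq_bigr => p px.
have pS : p.2 \in S by apply: sub; rewrite map_f.
rewrite (bigD1_seq p.2) //= eqxx big1 ?addr0 // => w.
by rewrite eq_sym => /negPf->; rewrite scale0r.
Qed.

(** A formal sum is a list in which words may repeat or cancel; regrouping it by word leaves only
    its coefficients. *)
Lemma flin_ext G x y : fcoef x =1 fcoef y -> flin G x = flin G y.
Proof.
move=> e; pose S := undup [seq p.2 | p <- x ++ y].
have uS : uniq S by apply: undup_uniq.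
rewrite !(@flin_fcoef _ _ S) //; first by apply: eq_bigr => w _; rewrite e.
- by move=> w wy; rewrite mem_undup map_cat mem_cat wy orbT.
- by move=> w wx; rewrite mem_undup map_cat mem_cat wx.
Qed.

(** Since [G] is only a function on words, with no multiplicativity, its vanishing on relators is
    required in every context [u _ v]. *)
Lemma flin_ideal G (rels : seq (fsum C T)) x :
    (forall u v, {in rels, forall r, flin (fun w => G (u ++ w ++ v)) r = 0}) ->
  in_ideal rels x -> flin G x = 0.
Proof.
move=> G0 [t [/allP trels ex]].
(* [y] turns the sum of coefficients in [in_ideal] into an actual formal sum, to which [flin_ext]
   applies. *)
pose y := flatten [seq fscale e.1.1.1
  (fmul [:: (1, e.1.1.2)] (fmul e.1.2 [:: (1, e.2)])) | e <- t].
have exy : fcoef x =1 fcoef y.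
  move=> w; rewrite ex /fcoef big_flatten big_map; apply: eq_bigr => e _.
  by rewrite big_map mulr_sumr.
rewrite (flin_ext G exy) flin_flatten big_map big_seq big1 // => e et.
by rewrite flin_scale flin_sandwich G0 ?scaler0 //; apply: trels.
Qed.

Lemma flin_qeq G (rels : seq (fsum C T)) x y :
    (forall u v, {in rels, forall r, flin (fun w => G (u ++ w ++ v)) r = 0}) ->
  qeq rels x y -> flin G x = flin G y.
Proof.
by move=> G0 /(flin_ideal G0); rewrite flin_sub => /eqP; rewrite subr_eq0 => /eqP.
Qed.

End LinearExtension.

(** * Closure properties of the two-sided ideal of relators *)

Section Ideal.
Variables (C : comNzRingType) (T : eqType) (rels : seq (fsum C T)).
Implicit Types (x y z : fsum C T) (w : seq T).

(** Coefficients become evaluations with values in [C^o], so coefficient identities follow from the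
    linearity of [flin]. *)
Lemma fcoefE x w : fcoef x w = flin (fun u => (u == w)%:R : C^o) x.
Proof.
rewrite /fcoef /flin big_mkcond; apply: eq_bigr => p _ /=.
by case: eqP => _; rewrite ?scaler0 //; apply/esym/mulr1.
Qed.

Lemma fcoef_add x y w : fcoef (fadd x y) w = fcoef x w + fcoef y w.
Proof. by rewrite !fcoefE flin_add. Qed.

Lemma fcoef_scale k x w : fcoef (fscale k x) w = k * fcoef x w.
Proof. by rewrite !fcoefE flin_scale. Qed.

Lemma in_ideal_ext x y : fcoef x =1 fcoef y -> in_ideal rels x -> in_ideal rels y.
Proof. by move=> e [t [tr ex]]; exists t; split=> // w; rewrite -e ex. Qed.

Lemma in_ideal0 x : fcoef x =1 (fun=> 0) -> in_ideal rels x.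
Proof. by move=> e; exists [::]; split=> // w; rewrite e big_nil. Qed.

Lemma in_idealD x y :
  in_ideal rels x -> in_ideal rels y -> in_ideal rels (fadd x y).
Proof.
move=> [t [tr ex]] [s [sr ey]]; exists (t ++ s); split=> [|w].
  by rewrite all_cat tr.
by rewrite fcoef_add ex ey big_cat.
Qed.

(** Scalars and outer words are absorbed into the triples [lambda, u, v] of the certificate;
    stability under scaling and products reduces to this case. *)
Lemma in_ideal_sandwich k u v x : in_ideal rels x ->
  in_ideal rels (fscale k (fmul [:: (1, u)] (fmul x [:: (1, v)]))).
Proof.
move=> [t [tr ex]].
exists [seq (k * e.1.1.1, u ++ e.1.1.2, e.1.2, e.2 ++ v) | e <- t].
split=> [|w]; first by rewrite all_map.
pose y := flatten [seq fscale e.1.1.1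
  (fmul [:: (1, e.1.1.2)] (fmul e.1.2 [:: (1, e.2)])) | e <- t].
have exy : fcoef x =1 fcoef y.
  move=> w'; rewrite ex /fcoef big_flatten big_map; apply: eq_bigr => e _.
  by rewrite big_map mulr_sumr.
rewrite fcoef_scale fcoefE flin_sandwich (flin_ext _ exy) flin_flatten !big_map.
rewrite mulr_sumr; apply: eq_bigr => e _; rewrite flin_scale fcoefE /= -mulrA.
congr (_ * (_ * _)); rewrite !flin_sandwich.
by apply: (@eq_flin _ _ C^o) => w'; rewrite !catA.
Qed.

Lemma in_ideal_mulr x y : in_ideal rels x -> in_ideal rels (fmul x y).
Proof.
move=> ix; elim: y => [|p y IH].
  apply: in_ideal0 => w; rewrite fcoefE flin_mul big1 // => p _.
  by rewrite flin_nil scaler0.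
apply: in_ideal_ext (in_idealD (in_ideal_sandwich p.1 [::] p.2 ix) IH) => w.
rewrite fcoef_add fcoef_scale !fcoefE flin_sandwich !flin_mul /=.
under [in RHS]eq_bigr do rewrite flin_cons scalerDr.
rewrite big_split /=; congr (_ + _).
rewrite /flin mulr_sumr; apply: eq_bigr => r _.
by rewrite /GRing.scale /= mulrCA.
Qed.

Lemma in_ideal_mull x y : in_ideal rels x -> in_ideal rels (fmul y x).
Proof.
move=> ix; elim: y => [|p y IH].
  by apply: in_ideal0 => w; rewrite fcoefE flin_mul big_nil.
apply: in_ideal_ext (in_idealD (in_ideal_sandwich p.1 p.2 [::] ix) IH) => w.
rewrite fcoef_add fcoef_scale !fcoefE flin_sandwich !flin_mul big_cons /=.
congr (_ + _); congr (_ *: (_ : C^o)).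
by apply: (@eq_flin _ _ C^o) => w'; rewrite cats0.
Qed.

Lemma in_idealZ k x : in_ideal rels x -> in_ideal rels (fscale k x).
Proof.
move=> /(in_ideal_sandwich k [::] [::]); apply: in_ideal_ext => w.
rewrite !fcoef_scale !fcoefE flin_sandwich; congr (_ * _).
by apply: (@eq_flin _ _ C^o) => u; rewrite cats0.
Qed.

Lemma in_ideal_rel r : r \in rels -> in_ideal rels r.
Proof.
move=> rr; exists [:: (1, [::], r, [::])]; split; first by rewrite /= rr.
move=> w; rewrite big_seq1 /= mul1r !fcoefE flin_sandwich.
by apply: (@eq_flin _ _ C^o) => u; rewrite cats0.
Qed.

Lemma qeq_ext x y : fcoef x =1 fcoef y -> qeq rels x y.
Proof.
move=> e; apply: in_ideal0 => w.
by rewrite fcoef_add fcoef_scale e mulN1r subrr.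
Qed.

Lemma qeq_sym x y : qeq rels x y -> qeq rels y x.
Proof.
move=> /(in_idealZ (-1)); apply: in_ideal_ext => w.
by rewrite fcoef_scale !fcoef_add !fcoef_scale; ring.
Qed.

Lemma qeq_trans x y z : qeq rels x y -> qeq rels y z -> qeq rels x z.
Proof.
move=> xy yz; apply: in_ideal_ext (in_idealD xy yz) => w.
by rewrite !(fcoef_add, fcoef_scale); ring.
Qed.

Lemma qeqD x x' y y' :
  qeq rels x x' -> qeq rels y y' -> qeq rels (fadd x y) (fadd x' y').
Proof.
move=> xx yy; apply: in_ideal_ext (in_idealD xx yy) => w.
by rewrite !(fcoef_add, fcoef_scale); ring.
Qed.

Lemma qeqZ k x y : qeq rels x y -> qeq rels (fscale k x) (fscale k y).
Proof.
move=> /(in_idealZ k); apply: in_ideal_ext => w.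
by rewrite !(fcoef_add, fcoef_scale); ring.
Qed.

Lemma fcoef_mulDl x y z w :
  fcoef (fmul (fadd x y) z) w = fcoef (fmul x z) w + fcoef (fmul y z) w.
Proof. by rewrite !fcoefE !flin_mul big_cat. Qed.

Lemma fcoef_mulDr x y z w :
  fcoef (fmul z (fadd x y)) w = fcoef (fmul z x) w + fcoef (fmul z y) w.
Proof.
rewrite !fcoefE !flin_mul -big_split.
by apply: eq_bigr => p _; rewrite flin_add scalerDr.
Qed.

Lemma fcoef_mulZl k x y w : fcoef (fmul (fscale k x) y) w = k * fcoef (fmul x y) w.
Proof.
rewrite !fcoefE !flin_mul big_map mulr_sumr; apply: eq_bigr => p _.
by rewrite -scalerA.
Qed.

Lemma fcoef_mulZr k x y w : fcoef (fmul x (fscale k y)) w = k * fcoef (fmul x y) w.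
Proof.
rewrite !fcoefE !flin_mul mulr_sumr; apply: eq_bigr => p _.
by rewrite flin_scale /GRing.scale /= mulrCA.
Qed.

Lemma fcoef_mulA x y z w :
  fcoef (fmul x (fmul y z)) w = fcoef (fmul (fmul x y) z) w.
Proof.
rewrite !fcoefE !flin_mul big_allpairs_dep; apply: eq_bigr => p _.
rewrite flin_mul scaler_sumr; apply: eq_bigr => r _ /=; rewrite scalerA.
by congr (_ *: (_ : C^o)); apply: (@eq_flin _ _ C^o) => s; rewrite catA.
Qed.

Lemma qeqM x x' y y' :
  qeq rels x x' -> qeq rels y y' -> qeq rels (fmul x y) (fmul x' y').
Proof.
move=> xx yy.
apply: in_ideal_ext (in_idealD (in_ideal_mulr y xx) (in_ideal_mull x' yy)) => w.
rewrite !(fcoef_add, fcoef_scale, fcoef_mulDl, fcoef_mulDr).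
by rewrite fcoef_mulZl fcoef_mulZr; ring.
Qed.

End Ideal.

(** * The quotient algebra, with Leibniz equality *)

Section Quotient.
Variables (C : comNzRingType) (T : eqType) (rels : seq (fsum C T)).

(** A class is the predicate of its members, so that extensionality turns [qeq] into equality;
    representatives come from choice. *)
Definition qalg := {P : fsum C T -> Prop | exists x, P = qeq rels x}.
Definition qpi (x : fsum C T) : qalg := exist _ (qeq rels x) (ex_intro _ x erefl).
Definition qrepr (u : qalg) : fsum C T := sval (cid (svalP u)).

HB.instance Definition _ := gen_eqMixin qalg.
HB.instance Definition _ := gen_choiceMixin qalg.

Lemma qpiP x y : qpi x = qpi y <-> qeq rels x y.
Proof.
split=> [[/(congr1 (fun P => P y)) ->]|xy]; first exact: qeq_ext.
apply/boolp.eq_exist; apply: funext => z; apply: propext.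
by split; apply: qeq_trans => //; apply: qeq_sym.
Qed.

Lemma qreprK : cancel qrepr qpi.
Proof.
move=> [P exP]; apply/boolp.eq_exist.
by rewrite /qrepr; case: cid => x /= ->.
Qed.

Lemma qpi_surj u : exists x, u = qpi x.
Proof. by exists (qrepr u); rewrite qreprK. Qed.

Lemma qrepr_pi x : qeq rels (qrepr (qpi x)) x.
Proof. by apply/qpiP; rewrite qreprK. Qed.

Lemma qpi_ext x y : fcoef x =1 fcoef y -> qpi x = qpi y.
Proof. by move=> e; apply/qpiP/qeq_ext. Qed.

Let qadd u v := qpi (fadd (qrepr u) (qrepr v)).
Let qscale k u := qpi (fscale k (qrepr u)).
Let qmul u v := qpi (fmul (qrepr u) (qrepr v)).

Let qaddE x y : qadd (qpi x) (qpi y) = qpi (fadd x y).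
Proof. by apply/qpiP/qeqD; apply: qrepr_pi. Qed.
Let qscaleE k x : qscale k (qpi x) = qpi (fscale k x).
Proof. by apply/qpiP/qeqZ; apply: qrepr_pi. Qed.
Let qmulE x y : qmul (qpi x) (qpi y) = qpi (fmul x y).
Proof. by apply/qpiP/qeqM; apply: qrepr_pi. Qed.

Let qE := (qaddE, qscaleE, qmulE).
Let fE := (fcoef_add, fcoef_scale, fcoef_mulDl, fcoef_mulDr, fcoef_mulZl, fcoef_mulZr).

Let fcoef0 w : fcoef ([::] : fsum C T) w = 0.
Proof. by rewrite fcoefE flin_nil. Qed.

Let addA : associative qadd.
Proof.
move=> u v w.
have [[x ->] [y ->] [z ->]] := And3 (qpi_surj u) (qpi_surj v) (qpi_surj w).
by rewrite !qE; apply: qpi_ext => t; rewrite !fE addrA.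
Qed.
Let addC : commutative qadd.
Proof.
move=> u v; have [[x ->] [y ->]] := conj (qpi_surj u) (qpi_surj v).
by rewrite !qE; apply: qpi_ext => t; rewrite !fE addrC.
Qed.
Let add0 : left_id (qpi [::]) qadd.
Proof.
by move=> u; have [x ->] := qpi_surj u; rewrite qE.
Qed.
Let addN : left_inverse (qpi [::]) (qscale (-1)) qadd.
Proof.
move=> u; have [x ->] := qpi_surj u; rewrite !qE.
by apply: qpi_ext => t; rewrite !fE fcoef0 mulN1r addNr.
Qed.

HB.instance Definition _ := GRing.isZmodule.Build qalg addA addC add0 addN.

Let mulA : associative qmul.
Proof.
move=> u v w.
have [[x ->] [y ->] [z ->]] := And3 (qpi_surj u) (qpi_surj v) (qpi_surj w).
by rewrite !qE; apply: qpi_ext => t; rewrite fcoef_mulA.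
Qed.
Let mul1 : left_id (qpi (fone C T)) qmul.
Proof.
move=> u; have [x ->] := qpi_surj u; rewrite qE; apply: qpi_ext => w.
by rewrite fcoefE flin_mul big_seq1 scale1r fcoefE.
Qed.
Let mulr_1 : right_id (qpi (fone C T)) qmul.
Proof.
move=> u; have [x ->] := qpi_surj u; rewrite qE; apply: qpi_ext => w.
rewrite !fcoefE flin_mul; apply: eq_bigr => p _.
by rewrite flin_cons flin_nil addr0 scale1r cats0.
Qed.
Let mulDl : left_distributive qmul qadd.
Proof.
move=> u v w.
have [[x ->] [y ->] [z ->]] := And3 (qpi_surj u) (qpi_surj v) (qpi_surj w).
by rewrite !qE; apply: qpi_ext => t; rewrite !fE.
Qed.
Let mulDr : right_distributive qmul qadd.
Proof.
move=> u v w.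
have [[x ->] [y ->] [z ->]] := And3 (qpi_surj u) (qpi_surj v) (qpi_surj w).
by rewrite !qE; apply: qpi_ext => t; rewrite !fE.
Qed.

HB.instance Definition _ :=
  GRing.Zmodule_isPzRing.Build qalg mulA mul1 mulr_1 mulDl mulDr.

Let scaleA a b u : qscale a (qscale b u) = qscale (a * b) u.
Proof.
have [x ->] := qpi_surj u; rewrite !qE; apply: qpi_ext => t.
by rewrite !fE mulrA.
Qed.
Let scale1 : left_id 1 qscale.
Proof.
move=> u; have [x ->] := qpi_surj u; rewrite !qE; apply: qpi_ext => t.
by rewrite !fE mul1r.
Qed.
Let scaleDr : right_distributive qscale +%R.
Proof.
move=> k u v; have [[x ->] [y ->]] := conj (qpi_surj u) (qpi_surj v).
rewrite -[+%R]/qadd !qE; apply: qpi_ext => t.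
by rewrite !fE mulrDr.
Qed.
Let scaleDl u : {morph qscale^~ u : a b / a + b}.
Proof.
move=> a b; have [x ->] := qpi_surj u; rewrite -[X in _ = X]/(qadd _ _) !qE.
by apply: qpi_ext => t; rewrite !fE mulrDl.
Qed.

HB.instance Definition _ :=
  GRing.Zmodule_isLmodule.Build C qalg scaleA scale1 scaleDr scaleDl.

Lemma qpi0 : qpi [::] = 0. Proof. by []. Qed.
Lemma qpiD x y : qpi (fadd x y) = qpi x + qpi y. Proof. exact/esym/qaddE. Qed.
Lemma qpiM x y : qpi (fmul x y) = qpi x * qpi y. Proof. exact/esym/qmulE. Qed.
Lemma qpiZ k x : qpi (fscale k x) = k *: qpi x. Proof. exact/esym/qscaleE. Qed.

(* [lalgType] requires [1 != 0], which may fail for an arbitrary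
   presentation, so the compatibility of scaling with the product is stated
   separately. *)
Lemma qscalerAl (k : C) (u v : qalg) :
  k *: (u * v) = (k *: u) * v.
Proof.
have [[x ->] [y ->]] := conj (qpi_surj u) (qpi_surj v).
rewrite -qpiM -(qpiZ k x) -qpiZ -qpiM.
by apply: qpi_ext => t; rewrite !fE.
Qed.
Lemma qscalerAr (k : C) (u v : qalg) :
  k *: (u * v) = u * (k *: v).
Proof.
have [[x ->] [y ->]] := conj (qpi_surj u) (qpi_surj v).
rewrite -qpiM -(qpiZ k y) -qpiZ -qpiM.
by apply: qpi_ext => t; rewrite !fE.
Qed.

Definition qword (w : seq T) : qalg := qpi [:: (1, w)].

Lemma qword_nil : qword [::] = 1. Proof. by []. Qed.
Lemma qword_cat u v : qword (u ++ v) = qword u * qword v.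
Proof. by rewrite /qword -qpiM /fmul /= mulr1. Qed.
Lemma qword_cons g v : qword (g :: v) = qword [:: g] * qword v.
Proof. by rewrite -qword_cat. Qed.

Lemma qpi_flin x : qpi x = flin qword x.
Proof.
elim: x => [|p x IH]; first by rewrite flin_nil.
rewrite flin_cons -IH -qpiZ -qpiD; apply: qpi_ext => w.
by rewrite !fcoefE !flin_cons /= mulr1.
Qed.

Lemma qpi_rel r : r \in rels -> qpi r = 0.
Proof.
move=> rr; rewrite -qpi0; apply/qpiP.
apply: in_ideal_ext (in_ideal_rel rr) => w.
by rewrite !fE fcoef0 mulr0 addr0.
Qed.

Lemma qword_eq2 (k : C) (u v : seq T) :
  [:: (1, u); (- k, v)] \in rels -> qword u = k *: qword v.
Proof.
move=> /qpi_rel; rewrite qpi_flin !flin_cons flin_nil /= addr0 scale1r scaleNr.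
by move=> /eqP; rewrite subr_eq0 => /eqP.
Qed.

Lemma qword_eq3 (k : C) (u v : seq T) :
  [:: (1, u); (k, v); (-1, [::])] \in rels -> qword u = 1 - k *: qword v.
Proof.
move=> /qpi_rel; rewrite qpi_flin !flin_cons flin_nil /= addr0 scale1r scaleN1r qword_nil.
by rewrite addrA => /eqP; rewrite subr_eq0 => /eqP <-; rewrite addrK.
Qed.

Lemma qcommX (x y : qalg) (k : C) n :
  x * y = k *: (y * x) -> x * y ^+ n = k ^+ n *: (y ^+ n * x).
Proof.
move=> xy; elim: n => [|n IH]; first by rewrite !expr0 scale1r mulr1 mul1r.
rewrite [in LHS]exprS mulrA xy -qscalerAl -mulrA IH -qscalerAr scalerA mulrA.
by rewrite -!exprS.
Qed.

Lemma qmul_flin (S : eqType) (G H : seq S -> qalg) (x y : fsum C S) :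
  flin G x * flin H y =
  \sum_(p <- x) \sum_(r <- y) (p.1 * r.1) *: (G p.2 * H r.2).
Proof.
rewrite mulr_suml; apply: eq_bigr => p _; rewrite mulr_sumr.
by apply: eq_bigr => r _; rewrite -qscalerAl -qscalerAr scalerA.
Qed.

End Quotient.

(** * The skew Laurent model *)

Section SkewLaurent.
Variables (F : fieldType) (c : F).
Hypothesis c_neq0 : c != 0.
Implicit Types (w u v : seq gen) (d e : int) (x : fsum F gen).

(* [suq2_rels q] is convertible to [suq2_relsF (real_complex R q)]. *)
Definition suq2_relsF : seq (fsum F gen) :=
  [:: [:: (1, [:: Ga; Gc]); (- c, [:: Gc; Ga])];
      [:: (1, [:: Ga; Gcs]); (- c, [:: Gcs; Ga])];
      [:: (1, [:: Gc; Gcs]); (-1, [:: Gcs; Gc])];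
      [:: (1, [:: Gcs; Gas]); (- c, [:: Gas; Gcs])];
      [:: (1, [:: Gc; Gas]); (- c, [:: Gas; Gc])];
      [:: (1, [:: Gas; Ga]); (1, [:: Gcs; Gc]); (-1, [::])];
      [:: (1, [:: Ga; Gas]); (c ^+ 2, [:: Gc; Gcs]); (-1, [::])]].

(** Starred generators have opposite degrees, so [a^* a] and [c c^*] have degree 0 like the unit and
    all relators are bihomogeneous. *)
Definition adeg (g : gen) : int := match g with Ga => 1 | Gas => -1 | _ => 0 end.
Definition cdeg (g : gen) : int := match g with Gc => 1 | Gcs => -1 | _ => 0 end.
Definition dega w : int := \sum_(g <- w) adeg g.
Definition degc w : int := \sum_(g <- w) cdeg g.

Lemma dega_cons g w : dega (g :: w) = adeg g + dega w.
Proof. by rewrite /dega big_cons. Qed.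
Lemma degc_cons g w : degc (g :: w) = cdeg g + degc w.
Proof. by rewrite /degc big_cons. Qed.
Lemma dega_cat u v : dega (u ++ v) = dega u + dega v.
Proof. by rewrite /dega big_cat. Qed.
Lemma degc_cat u v : degc (u ++ v) = degc u + degc v.
Proof. by rewrite /degc big_cat. Qed.
Lemma dega_nil : dega [::] = 0. Proof. by rewrite /dega big_nil. Qed.
Lemma degc_nil : degc [::] = 0. Proof. by rewrite /degc big_nil. Qed.

(** Consequently [K] acts on each bihomogeneous component by a scalar. *)
Lemma wtw_deg w : wtw w = - dega w - degc w.
Proof.
rewrite /wtw /dega /degc -!sumrN -big_split /=.
by apply: eq_bigr; case.
Qed.

(* An element of bidegree (d, e) of the skew Laurent ring is a finite sum of
   p_m t^d c^(e+m) c^*^m and is encoded by the polynomial of coefficients p_m;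
   left multiplication by the generator g multiplies it by [letter_poly g d]. *)
Definition letter_poly (g : gen) (d : int) : {poly F} :=
  match g with
  | Ga => 1
  | Gc => (c ^ (- d))%:P
  | Gcs => (c ^ (- d)) *: 'X
  | Gas => 1 - (c ^+ 2 * (c ^ (- d)) ^+ 2) *: 'X
  end.

(** A letter acts on what stands to its right, whose [a]-degree is [dega w' + d]. The degree in [c]
    never enters because [c] and [c^*] commute. *)
Fixpoint word_poly w d : {poly F} :=
  match w with
  | [::] => 1
  | g :: w' => letter_poly g (dega w' + d) * word_poly w' d
  end.

Lemma word_poly_cat u v d :
  word_poly (u ++ v) d = word_poly u (dega v + d) * word_poly v d.
Proof.
elim: u => [|g u IH] /=; first by rewrite mul1r.
by rewrite IH mulrA dega_cat addrA.
Qed.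

Definition bideg w : int * int := (dega w, degc w).

Lemma c_exprzS d : c ^ (1 + d) = c * c ^ d.
Proof. by rewrite expfzDr ?c_neq0. Qed.

Lemma suq2_relsF_homogeneous : {in suq2_relsF, forall r,
  exists D, all (fun p => bideg p.2 == D) r}.
Proof.
move=> r; rewrite !inE => /or4P[/eqP->|/eqP->|/eqP->|].
- by exists (1, 1); rewrite /= /bideg /dega /degc unlock.
- by exists (1, -1); rewrite /= /bideg /dega /degc unlock.
- by exists (0, 0); rewrite /= /bideg /dega /degc unlock.
case/or4P=> /eqP->.
- by exists (-1, -1); rewrite /= /bideg /dega /degc unlock.
- by exists (-1, 1); rewrite /= /bideg /dega /degc unlock.
- by exists (0, 0); rewrite /= /bideg /dega /degc unlock.
- by exists (0, 0); rewrite /= /bideg /dega /degc unlock.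
Qed.

Lemma word_poly_rel d : {in suq2_relsF, forall r,
  flin (fun w => word_poly w d) r = 0}.
Proof.
(* All powers of [c] in the relators are expressed through [c ^ (-1 - d)], which leaves polynomial
   identities for [ring]. *)
have E0 : c ^ (- d) = c * c ^ (-1 - d).
  by rewrite -c_exprzS; congr (_ ^ _); ring.
have E1 : c ^ (- (1 + d)) = c ^ (-1 - d) by congr (_ ^ _); ring.
have E2 : c ^ (- (-1 + d)) = c ^+ 2 * c ^ (-1 - d).
  by rewrite expr2 -mulrA -!c_exprzS; congr (_ ^ _); ring.
set k := c ^ (-1 - d) in E0 E1 E2 *.
by move=> r; rewrite !inE => /or4P[/eqP->|/eqP->|/eqP->|/or4P[]/eqP->];
   rewrite !flin_cons flin_nil /= !dega_cons ?dega_nil /= ?addr0 ?add0r;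
   rewrite ?E0 ?E1 ?E2 -!mul_polyC ?(polyCM, polyCN, polyC1) ?polyC_exp ?polyCM;
   ring.
Qed.

(* The polynomial encoding the component of bidegree (d, e) of the image of [x]. *)
Definition component_poly d e x : {poly F} :=
  flin (fun w => if bideg w == (d, e) then word_poly w 0 else 0) x.

Lemma component_poly_qeq d e x y :
  qeq suq2_relsF x y -> component_poly d e x = component_poly d e y.
Proof.
apply: flin_qeq => u v r rr.
have [D /allP rD] := suq2_relsF_homogeneous rr.
(* By homogeneity of the relator [r], the test on the bidegree of [u ++ w ++ v] has the same outcome
   [b] for all words [w] of [r]. *)
pose b := (dega u + D.1 + dega v, degc u + D.2 + degc v) == (d, e).
have -> : flin (fun w => if bideg (u ++ w ++ v) == (d, e)
    then word_poly (u ++ w ++ v) 0 else 0) r =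
  if b then word_poly u (D.1 + dega v + 0) *
     (flin (fun w => word_poly w (dega v + 0)) r * word_poly v 0) else 0.
  rewrite /flin mulr_suml mulr_sumr.
  have -> (P : {poly F}) : (if b then P else 0) = (b%:R : F) *: P.
    by case: b; rewrite ?scale1r ?scale0r.
  rewrite scaler_sumr [LHS]big_seq [RHS]big_seq; apply: eq_bigr => p pr.
  have /eqP<- := rD p pr.
  rewrite /bideg !dega_cat !degc_cat !addrA [X in X == _]/= -/(bideg _).
  have -> : b = ((dega u + dega p.2 + dega v, degc u + degc p.2 + degc v) == (d, e)).
    by rewrite /b -(eqP (rD p pr)).
  case: ifP => _; last by rewrite scale0r scaler0.
  by rewrite scale1r !word_poly_cat dega_cat addr0 -scalerAl -scalerAr.
by rewrite word_poly_rel // mul0r mulr0 if_same.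
Qed.

End SkewLaurent.

(** * Poincare-Birkhoff-Witt spanning *)

Lemma absz_add1 (e : int) (m : nat) :
  0 <= e + m%:Z -> absz (1 + e + m%:Z) = (absz (e + m%:Z)).+1.
Proof. lia. Qed.

Lemma absz_addS (e : int) (m : nat) :
  0 <= e + m%:Z -> absz (e + m.+1%:Z) = (absz (e + m%:Z)).+1.
Proof. lia. Qed.

Section PBW.
Variables (F : fieldType) (c : F).
Hypothesis c_neq0 : c != 0.
Local Notation A := (qalg (suq2_relsF c)).
Local Notation word := (qword (suq2_relsF c)).
Local Notation xa := (word [:: Ga]).
Local Notation xas := (word [:: Gas]).
Local Notation xc := (word [:: Gc]).
Local Notation xcs := (word [:: Gcs]).
Implicit Types (d e : int) (k : F) (l m n : nat) (P : {poly F}).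

Lemma suq2_ca : xc * xa = c^-1 *: (xa * xc).
Proof.
rewrite -!qword_cat (@qword_eq2 _ _ _ c [:: Ga; Gc] [:: Gc; Ga]).
  by rewrite scalerA mulVf // scale1r.
by rewrite !inE eqxx.
Qed.

Lemma suq2_csa : xcs * xa = c^-1 *: (xa * xcs).
Proof.
rewrite -!qword_cat (@qword_eq2 _ _ _ c [:: Ga; Gcs] [:: Gcs; Ga]).
  by rewrite scalerA mulVf // scale1r.
by rewrite !inE eqxx ?orbT.
Qed.

Lemma suq2_cas : xc * xas = c *: (xas * xc).
Proof.
by rewrite -!qword_cat (@qword_eq2 _ _ _ c [:: Gc; Gas] [:: Gas; Gc]) ?inE ?eqxx ?orbT.
Qed.

Lemma suq2_csas : xcs * xas = c *: (xas * xcs).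
Proof.
by rewrite -!qword_cat (@qword_eq2 _ _ _ c [:: Gcs; Gas] [:: Gas; Gcs]) ?inE ?eqxx ?orbT.
Qed.

Lemma suq2_ccs : xc * xcs = xcs * xc.
Proof.
by rewrite -!qword_cat (@qword_eq2 _ _ _ 1 [:: Gc; Gcs] [:: Gcs; Gc]) ?scale1r ?inE ?eqxx ?orbT.
Qed.

Lemma suq2_asa : xas * xa = 1 - xc * xcs.
Proof.
rewrite suq2_ccs -!qword_cat (@qword_eq3 _ _ _ 1 [:: Gas; Ga] [:: Gcs; Gc]) ?scale1r //.
by rewrite !inE eqxx ?orbT.
Qed.

Lemma suq2_aas : xa * xas = 1 - c ^+ 2 *: (xc * xcs).
Proof.
rewrite -!qword_cat (@qword_eq3 _ _ _ (c ^+ 2) [:: Ga; Gas] [:: Gc; Gcs]) //.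
by rewrite !inE eqxx ?orbT.
Qed.

Definition apow d : A :=
  match d with Posz n => xa ^+ n | Negz n => xas ^+ n.+1 end.

Lemma apow_comm (x : A) d :
  x * xa = c^-1 *: (xa * x) -> x * xas = c *: (xas * x) ->
  x * apow d = c ^ (- d) *: (apow d * x).
Proof.
move=> xa1 xas1; case: d => n /=.
  by rewrite (qcommX _ xa1) exprVn -exprnN.
by rewrite (qcommX _ xas1).
Qed.

Lemma apow_xc d : xc * apow d = c ^ (- d) *: (apow d * xc).
Proof. exact: apow_comm suq2_ca suq2_cas. Qed.

Lemma apow_xcs d : xcs * apow d = c ^ (- d) *: (apow d * xcs).
Proof. exact: apow_comm suq2_csa suq2_csas. Qed.

Lemma apow_xccs d :
  xc * xcs * apow d = (c ^ (- d)) ^+ 2 *: (apow d * (xc * xcs)).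
Proof.
rewrite -mulrA apow_xcs -qscalerAr mulrA apow_xc -qscalerAl scalerA.
by rewrite mulrA expr2.
Qed.

Lemma apow_succ d : 0 <= d -> xa * apow d = apow (1 + d).
Proof. by case: d => // n _; rewrite /= -exprS. Qed.

Lemma apow_pred d : d <= 0 -> xas * apow d = apow (-1 + d).
Proof.
by case: d => [[|n]|n] // _; rewrite /= mulr1 expr1.
Qed.

(** For [d < 0] one factor [a^*] is split off and [a a^* = 1 - q^2 c c^*] is applied; moving [c c^*]
    past the remaining power produces the squared power of [c]. *)
Lemma xa_apow d : d < 0 -> xa * apow d =
  apow (1 + d) - (c ^+ 2 * (c ^ (- (1 + d))) ^+ 2) *: (apow (1 + d) * (xc * xcs)).
Proof.
move=> d0; have Ed : d = -1 + (1 + d) by ring.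
rewrite [in LHS]Ed -apow_pred ?(mulrA xa) ?suq2_aas; last by lia.
by rewrite mulrBl mul1r -qscalerAl apow_xccs scalerA.
Qed.

Lemma xas_apow d : 0 < d -> xas * apow d =
  apow (-1 + d) - (c ^+ 2 * (c ^ (- d)) ^+ 2) *: (apow (-1 + d) * (xc * xcs)).
Proof.
move=> d0; have Ed : d = 1 + (-1 + d) by ring.
rewrite [in LHS]Ed -apow_succ ?(mulrA xas) ?suq2_asa; last by lia.
rewrite mulrBl mul1r apow_xccs -exprMn.
suff -> : c ^ (- (-1 + d)) = c * c ^ (- d) by [].
by rewrite -[X in X * _]expr1z -expfzDr //; congr (_ ^ _); ring.
Qed.

Definition mon d l m : A := apow d * (xc ^+ l * xcs ^+ m).

Lemma xc_mon d l m : xc * mon d l m = c ^ (- d) *: mon d l.+1 m.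
Proof. by rewrite /mon mulrA apow_xc -qscalerAl -mulrA exprS !mulrA. Qed.

Lemma xcs_xcX l : xcs * xc ^+ l = xc ^+ l * xcs.
Proof. by apply: commrX; rewrite /GRing.comm suq2_ccs. Qed.

Lemma xcs_mon d l m : xcs * mon d l m = c ^ (- d) *: mon d l m.+1.
Proof.
by rewrite /mon mulrA apow_xcs -qscalerAl -mulrA (mulrA xcs) xcs_xcX -mulrA -exprS.
Qed.

Lemma shift_mon (x : A) d d' k l m :
    x * apow d = apow d' - k *: (apow d' * (xc * xcs)) ->
  x * mon d l m = mon d' l m - k *: mon d' l.+1 m.+1.
Proof.
move=> xE; rewrite /mon mulrA xE mulrBl -qscalerAl -2!mulrA (mulrA xcs) xcs_xcX.
by rewrite -mulrA -exprS (mulrA xc) -exprS.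
Qed.

(* The same pairs (k, m) expand [x] in the k a^d c^(e+m) c^*^m and [P] in the
   k 'X^m; for d < 0, a^d stands for a^*^-d. *)
Definition pbw d e (x : A) P := exists t : seq (F * nat),
  [/\ all (fun p => 0 <= e + p.2%:Z) t,
      x = \sum_(p <- t) p.1 *: mon d (absz (e + p.2%:Z)) p.2
    & P = \sum_(p <- t) p.1 *: 'X^(p.2)].

Lemma pbw0 d e : pbw d e 0 0.
Proof. by exists [::]; rewrite !big_nil. Qed.

Lemma pbwD d e x y P Q : pbw d e x P -> pbw d e y Q -> pbw d e (x + y) (P + Q).
Proof.
move=> [t [tp -> ->]] [r [rp -> ->]]; exists (t ++ r).
by rewrite all_cat tp rp !big_cat.
Qed.

Lemma pbwZ d e x P k : pbw d e x P -> pbw d e (k *: x) (k *: P).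
Proof.
move=> [t [tp -> ->]]; exists [seq (k * p.1, p.2) | p <- t].
rewrite all_map !big_map !scaler_sumr; split=> //;
  by apply: eq_bigr => p _; rewrite scalerA.
Qed.

Lemma pbw_c d e x P : pbw d e x P -> pbw d (1 + e) (xc * x) (c ^ (- d) *: P).
Proof.
move=> [t [tp -> ->]]; exists [seq (c ^ (- d) * p.1, p.2) | p <- t].
rewrite all_map !big_map; split.
- by apply: sub_all tp => p /= ep; lia.
- rewrite mulr_sumr [LHS]big_seq [RHS]big_seq; apply: eq_bigr => p pt.
  rewrite absz_add1 ?(allP tp p pt) //.
  by rewrite -qscalerAr xc_mon scalerA mulrC.
- by rewrite scaler_sumr; apply: eq_bigr => p _; rewrite scalerA.
Qed.

Lemma pbw_cs d e x P :
  pbw d e x P -> pbw d (-1 + e) (xcs * x) (c ^ (- d) *: ('X * P)).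
Proof.
move=> [t [tp -> ->]]; exists [seq (c ^ (- d) * p.1, p.2.+1) | p <- t].
rewrite all_map !big_map; split.
- by apply: sub_all tp => p /= ep; lia.
- rewrite mulr_sumr; apply: eq_bigr => p _.
  have -> : -1 + e + p.2.+1%:Z = e + p.2%:Z by lia.
  by rewrite -qscalerAr xcs_mon scalerA mulrC.
- rewrite mulr_sumr scaler_sumr; apply: eq_bigr => p _.
  by rewrite -scalerAr -exprS scalerA.
Qed.

(** This covers [a] and [a^*] for both signs of [d]: [k = 0] when the power only grows, and [k]
    nonzero when a pair of [a] and [a^*] is contracted. *)
Lemma pbw_shift (g x : A) d d' e k P :
    g * apow d = apow d' - k *: (apow d' * (xc * xcs)) ->
  pbw d e x P -> pbw d' e (g * x) ((1 - k *: 'X) * P).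
Proof.
move=> gE [t [tp -> ->]].
exists (t ++ [seq (- k * p.1, p.2.+1) | p <- t]).
rewrite all_cat all_map !big_cat !big_map /= tp; split.
- by apply: sub_all tp => p /= ep; lia.
- rewrite mulr_sumr -big_split [LHS]big_seq [RHS]big_seq; apply: eq_bigr => p pt.
  rewrite [in RHS]absz_addS ?(allP tp p pt) //.
  by rewrite -qscalerAr (shift_mon _ _ gE) scalerBr scalerA mulNr scaleNr mulrC.
- rewrite mulrBl mul1r mulr_sumr -sumrN; congr (_ + _); apply: eq_bigr => p _.
  by rewrite -scalerAr -scalerAl -exprS scalerA mulNr scaleNr mulrC.
Qed.

(* The polynomial P_d encoding [apow d] in the skew Laurent ring. *)
Definition apow_poly d : {poly F} :=
  match d with
  | Posz _ => 1
  | Negz n => \prod_(i < n.+1) letter_poly c Gas (- i%:Z)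
  end.

Lemma apow_poly_pred d :
  d <= 0 -> apow_poly (-1 + d) = letter_poly c Gas d * apow_poly d.
Proof.
case: d => [[|n]|n] // _; first by rewrite [LHS]big_ord1 mulr1.
rewrite -[-1]/(Negz 0) [LHS]big_ord_recr mulrC /=; congr (_ * _).
Qed.

(** The reduction to normal form is run in parallel with the computation in the model, so one [P]
    records both. Since [apow_poly] is nonzero, the image in the model then determines the normal
    form. *)
Lemma word_pbw w : exists2 P, pbw (dega w) (degc w) (word w) P
  & word_poly c w 0 = apow_poly (dega w) * P.
Proof.
elim: w => [|g w [P wP E]].
  exists 1; last by rewrite dega_nil mulr1.
  exists [:: (1, 0)]; rewrite dega_nil degc_nil !big_seq1 /mon /= !scale1r.
  by split; rewrite // !mulr1.
rewrite qword_cons dega_cons degc_cons /= addr0 E.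
move: (dega w) (degc w) (word w) wP => d e x wP {E}.
case: g => /=; rewrite ?add0r.
- case: (leP 0 d) => d0.
    exists P; last by rewrite mul1r; case: d d0 {wP}.
    have := @pbw_shift xa x d (1 + d) e 0 P.
    by rewrite !scale0r !subr0 mul1r apow_succ //; apply.
  (* Here [a] contracts with one [a^*]: the factor that [apow_poly] loses from [d] to [1 + d] passes
     to [P]. *)
  exists (letter_poly c Gas (1 + d) * P).
    by apply: pbw_shift wP; rewrite xa_apow.
  rewrite mul1r mulrA [_ * letter_poly _ _ _]mulrC -apow_poly_pred; last by lia.
  by congr (apow_poly _ * _); ring.
- case: (leP d 0) => d0.
    exists P; last by rewrite apow_poly_pred // -mulrA.
    have := @pbw_shift xas x d (-1 + d) e 0 P.
    by rewrite !scale0r !subr0 mul1r apow_pred //; apply.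
  (* For [d > 0] both values of [apow_poly] are 1, and the contraction factor goes entirely into
     [P]. *)
  exists (letter_poly c Gas d * P); first by apply: pbw_shift wP; rewrite xas_apow.
  have -> : apow_poly d = 1 by case: d d0 {wP}.
  have -> : apow_poly (-1 + d) = 1 by move: d d0 {wP} => [[|n]|n].
  by rewrite !mul1r.
- by exists (c ^ (- d) *: P); [exact: pbw_c | rewrite mul_polyC scalerAr].
- exists (c ^ (- d) *: ('X * P)); first exact: pbw_cs.
  by rewrite -!scalerAr -!scalerAl mulrCA.
Qed.

End PBW.

(** * The action of F on the model *)

Section Jackson.
Variables (F : fieldType) (t : F).
Implicit Types (p : {poly F}) (k : F).

Definition qint n : F := \sum_(j < n) t ^+ j.

Lemma qintS n : qint n.+1 = 1 + t * qint n.
Proof.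
rewrite /qint big_ord_recl expr0 mulr_sumr; congr (_ + _).
by apply: eq_bigr => i _; rewrite -exprS.
Qed.

(** The Jackson derivative [(p(tX) - p(X)) / ((t - 1) X)], given on coefficients to avoid the
    division. *)
Definition jackson p : {poly F} := \poly_(i < size p) (qint i.+1 * p`_i.+1).

Lemma coef_jackson p i : (jackson p)`_i = qint i.+1 * p`_i.+1.
Proof.
rewrite coef_poly; case: ltnP => // pi; rewrite nth_default ?mulr0 //.
exact: leq_trans pi _.
Qed.

Lemma jacksonD p1 p2 : jackson (p1 + p2) = jackson p1 + jackson p2.
Proof. by apply/polyP => i; rewrite !(coefD, coef_jackson) mulrDr. Qed.

Lemma jacksonZ k p : jackson (k *: p) = k *: jackson p.
Proof. by apply/polyP => i; rewrite !(coefZ, coef_jackson) mulrCA. Qed.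

Lemma jacksonB p1 p2 : jackson (p1 - p2) = jackson p1 - jackson p2.
Proof. by rewrite jacksonD -scaleN1r jacksonZ scaleN1r. Qed.

Lemma jackson0 : jackson 0 = 0.
Proof. by rewrite -[X in jackson X](scale0r 0) jacksonZ scale0r. Qed.

Lemma jackson1 : jackson 1 = 0.
Proof. by apply/polyP => i; rewrite coef_jackson coef1 coef0 mulr0. Qed.

(** The twisted Leibniz rule with left factor ['X]; on coefficients it is the recursion [qintS]. *)
Lemma jacksonXM p : jackson ('X * p) = p + t *: ('X * jackson p).
Proof.
apply/polyP => i; rewrite coef_jackson coefD coefZ !coefXM /= qintS.
case: i => [|i] /=; last by rewrite coef_jackson mulrDl mul1r mulrA.
by rewrite /qint big_ord0 !mulr0 !addr0 mul1r.
Qed.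

Lemma jacksonZXM k p :
  jackson ((k *: 'X) * p) = k *: (p + t *: ('X * jackson p)).
Proof. by rewrite -scalerAl jacksonZ jacksonXM. Qed.

Lemma jackson1BZXM k p :
  jackson ((1 - k *: 'X) * p) = jackson p - k *: (p + t *: ('X * jackson p)).
Proof. by rewrite mulrBl mul1r jacksonB jacksonZXM. Qed.

Lemma jackson_flin (T : eqType) (G : seq T -> {poly F}) x :
  jackson (flin G x) = flin (fun w => jackson (G w)) x.
Proof.
elim: x => [|p x IH]; first by rewrite !flin_nil jackson0.
by rewrite !flin_cons jacksonD jacksonZ IH.
Qed.

Lemma jackson_eq0 p :
  (forall n, qint n.+1 != 0) -> jackson p = 0 -> p = (p`_0)%:P.
Proof.
move=> q0 p0; apply/polyP => -[|i]; rewrite coefC //=.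
have /eqP := congr1 (fun r : {poly F} => r`_i) p0.
by rewrite coef_jackson coef0 mulf_eq0 (negPf (q0 i)) => /eqP.
Qed.

Lemma qint_neq0 n : t ^+ n.+1 != 1 -> qint n.+1 != 0.
Proof. by apply: contraNneq => q0; rewrite -subr_eq0 subrX1 -/(qint _) q0 mulr0. Qed.

End Jackson.

(** * F acts on the model as a Jackson derivative *)

Section LoweringOperator.
Variables (F : fieldType) (s : F).
Hypothesis s_neq0 : s != 0.
Local Notation c := (s ^+ 2).
Implicit Types (w : seq gen) (d e : int).

Definition FgenF (g : gen) : fsum F gen :=
  match g with
  | Ga | Gc => [::]
  | Gas => [:: (1, [:: Gc])]
  | Gcs => [:: (- c^-1, [:: Ga])]
  end.

(* [s] and [Fw] abstract [sq q] and [Fword q] from the base field [R[i]]. *)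
Variable Fw : seq gen -> fsum F gen.
Hypothesis Fw_nil : Fw [::] = [::].
Hypothesis Fw_cons : forall g w, Fw (g :: w) =
  [seq (p.1 * s ^ wtw w, p.2 ++ w) | p <- FgenF g]
  ++ [seq (s ^ (- wt g) * p.1, g :: p.2) | p <- Fw w].

Lemma bideg_Fw w : {in Fw w, forall p, bideg p.2 = (1 + dega w, 1 + degc w)}.
Proof.
elim: w => [|g w IH] p; rewrite ?Fw_nil // Fw_cons mem_cat => /orP[|/mapP[r /IH E ->]].
  by case: g => //=; rewrite inE => /eqP -> /=;
    rewrite /bideg !(dega_cons, degc_cons) /=; congr (_, _); ring.
move: E; rewrite /bideg !(dega_cons, degc_cons) => -[-> ->].
by congr (_, _); ring.
Qed.

Let J := jackson (c ^- 2).

(** By induction on the word, F on the first letter and F on the tail match the two kinds of terms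
    in the twisted Leibniz rule for the Jackson derivative. The base [c ^- 2] and the scalar are
    what the powers of [s] from the action of [K] require. *)
Lemma word_poly_Fw w : flin (word_poly c ^~ 0) (Fw w) =
  (- s ^ (dega w - degc w - 3)) *: J (word_poly c w 0).
Proof.
have cE z : c ^ z = s ^ (2 * z) by rewrite exprnP exprz_exp.
elim: w => [|g w IH]; first by rewrite Fw_nil flin_nil [J _]jackson1 scaler0.
rewrite Fw_cons -[_ ++ _]/(fadd _ _) flin_add.
(* F raises the [a]-degree of the tail by one, so the letter polynomial of [g] is evaluated at
   [1 + dega w] here. *)
have -> : flin (word_poly c ^~ 0) [seq (s ^ (- wt g) * p.1, g :: p.2) | p <- Fw w] =
    letter_poly c g (1 + dega w) *
    ((- (s ^ (- wt g) * s ^ (dega w - degc w - 3))) *: J (word_poly c w 0)).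
  rewrite -mulrN -scalerA -IH /flin big_map scaler_sumr mulr_sumr.
  rewrite [LHS]big_seq [RHS]big_seq; apply: eq_bigr => p /bideg_Fw[dp _].
  by rewrite /= addr0 dp -!scalerAr scalerA.
have -> : flin (word_poly c ^~ 0) [seq (p.1 * s ^ wtw w, p.2 ++ w) | p <- FgenF g] =
    match g with
    | Ga | Gc => 0
    | Gas => (s ^ wtw w * c ^ (- dega w)) *: word_poly c w 0
    | Gcs => (- (c^-1 * s ^ wtw w)) *: word_poly c w 0
    end.
  case: g => /=; rewrite ?flin_cons flin_nil ?addr0 //= ?addr0.
    by rewrite mul1r mul_polyC scalerA.
  by rewrite mul1r mulNr.
rewrite [word_poly c (g :: w) 0]/= addr0 dega_cons degc_cons wtw_deg.
move: (word_poly c w 0) (dega w) (degc w) => p d e {IH}.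
have Jc : J p = jackson (c ^- 2) p by [].
(* Every power is split into [s ^ d], [s ^ e] and fixed powers of [s], so that the four cases become
   rational identities for [field]. *)
have sdN : s ^ (- d - e) = (s ^ d)^-1 * (s ^ e)^-1.
  by rewrite expfzDr // !invr_expz.
have sd k : s ^ (k + d - e) = s ^ k * s ^ d * (s ^ e)^-1.
  by rewrite !expfzDr // invr_expz.
have cd : c ^ (- d) = (s ^ d) ^- 2 by rewrite cE mulrC -exprz_exp -invr_expz -exprnP exprVn.
have c1d : c ^ (- (1 + d)) = (s * s ^ d) ^- 2.
  by rewrite cE mulrC -exprz_exp -invr_expz -exprnP exprVn expfzDr.
have -> : d - e - 3 = -3 + d - e by ring.
have Sd : s ^ d != 0 by rewrite expfz_neq0.
have Se : s ^ e != 0 by rewrite expfz_neq0.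
case: g; rewrite [letter_poly _ _ _]/= ?cd ?c1d ?sdN sd.
- have -> : adeg Ga + d - (cdeg Ga + e) - 3 = -2 + d - e by rewrite /=; ring.
  rewrite sd [letter_poly _ _ _]/= !mul1r add0r; congr (_ *: _).
  rewrite -[s ^ (-3)]/(s ^- 3) -[s ^ (-2)]/(s ^- 2) -[s ^ (- wt _)]/(s ^+ 1).
  by field; rewrite s_neq0 Se.
- have -> : adeg Gas + d - (cdeg Gas + e) - 3 = -4 + d - e by rewrite /=; ring.
  rewrite sd [letter_poly _ _ _]/= [J (_ * _)]jackson1BZXM -Jc cd.
  rewrite mulrBl mul1r -scalerAl -scalerAr.
  apply/polyP => i; rewrite !(coefD, coefN, coefZ).
  rewrite -[s ^ (-3)]/(s ^- 3) -[s ^ (-4)]/(s ^- 4) -[s ^ (- wt _)]/(s ^- 1).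
  by field; rewrite s_neq0 Sd Se.
- have -> : adeg Gc + d - (cdeg Gc + e) - 3 = -4 + d - e by rewrite /=; ring.
  rewrite sd [letter_poly _ _ _]/= add0r !mul_polyC [J (_ *: _)]jacksonZ cd !scalerA.
  congr (_ *: _).
  rewrite -[s ^ (-3)]/(s ^- 3) -[s ^ (-4)]/(s ^- 4) -[s ^ (- wt _)]/(s ^+ 1).
  by field; rewrite s_neq0 Sd Se.
- have -> : adeg Gcs + d - (cdeg Gcs + e) - 3 = -2 + d - e by rewrite /=; ring.
  rewrite sd [letter_poly _ _ _]/= [J (_ * _)]jacksonZXM -Jc cd -scalerAl -scalerAr.
  apply/polyP => i; rewrite !(coefD, coefN, coefZ).
  rewrite -[s ^ (-3)]/(s ^- 3) -[s ^ (-2)]/(s ^- 2) -[s ^ (- wt _)]/(s ^- 1).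
  by field; rewrite s_neq0 Sd Se.
Qed.

End LoweringOperator.

(** * Holomorphic sections *)

Section ConstantComponents.
Variables (F : fieldType) (c : F).
Hypothesis c_neq0 : c != 0.
Local Notation A := (qalg (suq2_relsF c)).
Local Notation word := (qword (suq2_relsF c)).
Implicit Types (d e : int) (k : F) (P : {poly F}) (x : fsum F gen).

Definition component d e x : A :=
  flin (fun w => if bideg w == (d, e) then word w else 0) x.

Lemma component_pbw d e x :
  exists2 P, pbw d e (component d e x) P & component_poly c d e x = apow_poly c d * P.
Proof.
rewrite /component /component_poly; elim: x => [|p x [P xP xE]].
  by exists 0; rewrite ?flin_nil ?mulr0 //; exact: pbw0.
rewrite !flin_cons xE; case: eqP xP {xE} => [[<- <-]|_] xP; last first.
  by exists P; rewrite ?scaler0 add0r.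
have [Q wQ ->] := word_pbw c_neq0 p.2.
exists (p.1 *: Q + P); first by apply: pbwD => //; exact: pbwZ.
by rewrite mulrDr scalerAr.
Qed.

Lemma sum_homogeneous x :
  qpi (suq2_relsF c) x =
  \sum_(D <- undup [seq bideg p.2 | p <- x]) component D.1 D.2 x.
Proof.
rewrite qpi_flin /component exchange_big /flin /= [LHS]big_seq [RHS]big_seq.
apply: eq_bigr => p px.
have pD : bideg p.2 \in [seq bideg r.2 | r <- x] by apply/mapP; exists p.
rewrite (bigD1_seq (bideg p.2)) ?undup_uniq ?mem_undup //.
rewrite -surjective_pairing eqxx big1 => [|D /negPf]; first exact/esym/addr0.
by rewrite -surjective_pairing eq_sym => ->; rewrite scaler0.
Qed.

(** The list [t] may repeat exponents; after regrouping only the coefficients of the polynomial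
    matter. *)
Lemma sum_monomials (V : lmodType F) (f : nat -> V) (t : seq (F * nat)) :
  let P := \sum_(p <- t) p.1 *: 'X^(p.2) in
  \sum_(p <- t) p.1 *: f p.2 = \sum_(i < (\max_(p <- t) p.2).+1) P`_i *: f i.
Proof.
move=> P; under [RHS]eq_bigr do rewrite coef_sum scaler_suml.
rewrite exchange_big /= [LHS]big_seq [RHS]big_seq; apply: eq_bigr => p pt.
have pN : (p.2 < (\max_(p <- t) p.2).+1)%N by rewrite ltnS leq_bigmax_seq.
rewrite (bigD1 (Ordinal pN)) //= coefZ coefXn eqxx mulr1 big1 ?addr0 // => i.
by rewrite coefZ coefXn -val_eqE /= => /negPf->; rewrite mulr0 scale0r.
Qed.

(** Only the term with exponent 0 survives. If [k] is nonzero, some pair of the certificate has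
    exponent 0, and its side condition reads [0 <= e]. *)
Lemma pbw_polyC d e (x : A) k :
  pbw d e x k%:P -> x = k *: mon c d (absz e) 0 /\ (k != 0 -> 0 <= e).
Proof.
move=> [t [/allP tp -> Ek]]; split.
  rewrite (sum_monomials (fun m => mon c d (absz (e + m%:Z)) m)) -Ek.
  rewrite big_ord_recl [X in _ + X]big1 => [|i _]; last by rewrite coefC scale0r.
  by rewrite coefC !addr0.
move=> k0; suff /hasP[p pt /eqP p2] : has (fun p => p.2 == 0) t.
  by have := tp _ pt; rewrite p2 addr0.
apply: contraNT k0 => /hasPn t0.
have -> : k = k%:P`_0 by rewrite coefC.
rewrite Ek coef_sum big_seq big1 // => p /t0.
by rewrite coefZ coefXn eq_sym => /negPf->; rewrite mulr0.
Qed.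

Lemma size_apow_poly n : (1 < size (apow_poly c (Negz n)))%N.
Proof.
have sz k : k != 0 -> size (1 - k *: 'X) = 2.
  by move=> k0; rewrite addrC size_polyDl size_polyN size_scale ?size_polyX ?size_poly1.
have sl i : size (letter_poly c Gas i) = 2.
  by rewrite sz // mulf_neq0 ?expf_neq0 // expfz_neq0.
rewrite /apow_poly size_prod => [|i _]; last by rewrite -size_poly_gt0 sl.
under eq_bigr do rewrite sl.
by rewrite sum_nat_const card_ord; lia.
Qed.

(** For [d < 0] the component polynomial is a multiple of the nonconstant [apow_poly c d], so it can
    be constant only when the cofactor vanishes. *)
Lemma component_polyC d e x k : component_poly c d e x = k%:P ->
  component d e x = 0 \/
  [/\ 0 <= d, 0 <= e, k != 0 & component d e x = k *: mon c d (absz e) 0].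
Proof.
have [P xP ->] := component_pbw d e x.
have [P0 _|P0] := eqVneq P 0.
  by left; move: xP; rewrite P0 => /pbw_polyC[->]; rewrite scale0r.
case: d xP => n xP; last first.
  have a0 : apow_poly c (Negz n) != 0.
    by rewrite -size_poly_gt0 (ltn_trans _ (size_apow_poly n)).
  move=> /(congr1 (fun p : {poly F} => size p)); rewrite size_mul // => E.
  have := size_polyC_leq1 k; rewrite -E leqNgt; case/negP.
  move: P0 (size_apow_poly n); rewrite -size_poly_gt0.
  by case: (size P) => // m _; case: (size _) => [|[|l]] //; rewrite addnS.
rewrite mul1r => E; move: xP P0; rewrite E polyC_eq0 => /pbw_polyC[-> e0] k0.
by right; split=> //; exact: e0.
Qed.

End ConstantComponents.

Section HolomorphicSections.
Variables (F : fieldType) (s : F).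
Hypotheses (s_neq0 : s != 0) (s_inj : injective (exprz s)).
Local Notation c := (s ^+ 2).
Local Notation rels := (suq2_relsF c).
Local Notation A := (qalg rels).
Local Notation word := (qword rels).
Implicit Types (d e : int) (x y : fsum F gen) (n m : nat).

Variable Fw : seq gen -> fsum F gen.
Hypothesis Fw_nil : Fw [::] = [::].
Hypothesis Fw_cons : forall g w, Fw (g :: w) =
  [seq (p.1 * s ^ wtw w, p.2 ++ w) | p <- FgenF s g]
  ++ [seq (s ^ (- wt g) * p.1, g :: p.2) | p <- Fw w].

Let c_neq0 : c != 0. Proof. by rewrite expf_neq0. Qed.

Definition Kf x : fsum F gen := [seq (s ^ wtw p.2 * p.1, p.2) | p <- x].
Definition Ff x : fsum F gen := flatten [seq fscale p.1 (Fw p.2) | p <- x].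
(** The counterpart of [H0] over the abstract field, stated in the quotient and without the
    invertible scalar of [X_-]. *)
Definition hol n x :=
  qpi rels (Kf x) = s ^ (- n%:Z) *: qpi rels x /\ qpi rels (Ff (Kf x)) = 0.

Lemma flin_Kf (V : lmodType F) (G : seq gen -> V) x :
  flin G (Kf x) = flin (fun w => s ^ wtw w *: G w) x.
Proof. by rewrite /flin big_map; apply: eq_bigr => p _; rewrite scalerA mulrC. Qed.

Lemma flin_Ff (V : lmodType F) (G : seq gen -> V) x :
  flin G (Ff x) = flin (fun w => flin G (Fw w)) x.
Proof.
by rewrite flin_flatten big_map; apply: eq_bigr => p _; rewrite flin_scale.
Qed.

Lemma component_poly_Kf d e x :
  component_poly c d e (Kf x) = s ^ (- d - e) *: component_poly c d e x.
Proof.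
rewrite /component_poly flin_Kf /flin scaler_sumr; apply: eq_bigr => p _.
case: eqP => [[<- <-]|_]; last by rewrite !scaler0.
by rewrite wtw_deg !scalerA mulrC.
Qed.

Lemma component_poly_Ff d e x : component_poly c (1 + d) (1 + e) (Ff x) =
  (- s ^ (d - e - 3)) *: jackson (c ^- 2) (component_poly c d e x).
Proof.
rewrite /component_poly flin_Ff jackson_flin /flin scaler_sumr; apply: eq_bigr => p _.
rewrite scalerA mulrC -scalerA; congr (_ *: _).
have bF r : r \in Fw p.2 -> (bideg r.2 == (1 + d, 1 + e)) = (bideg p.2 == (d, e)).
  move=> /(bideg_Fw Fw_nil Fw_cons) ->.
  by rewrite !xpair_eqE !(inj_eq (addrI _)).
case: eqP bF => [[<- <-]|_] bF.
  rewrite -(word_poly_Fw s_neq0 Fw_nil Fw_cons).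
  by rewrite /flin [LHS]big_seq [RHS]big_seq; apply: eq_bigr => r /bF ->.
rewrite jackson0 scaler0 /flin big_seq big1 // => r /bF ->.
by rewrite scaler0.
Qed.

(** Annihilation by F makes the Jackson derivative of each component zero, hence the component
    constant; the eigenvalue of [K] then fixes the total degree. *)
Lemma hol_component_poly n x d e : hol n x ->
  exists2 k, component_poly c d e x = k%:P & k != 0 -> d + e = n%:Z.
Proof.
move=> [xK xF].
have sz z : s ^ z != 0 by rewrite expfz_neq0.
have := component_poly_qeq c_neq0 (1 + d) (1 + e)
  ((qpiP _ _ _).1 (xF : _ = qpi rels [::])).
rewrite component_poly_Ff component_poly_Kf jacksonZ /component_poly flin_nil => /eqP.
rewrite scalerA scaler_eq0 mulf_eq0 oppr_eq0 !(negPf (sz _)) /= => /eqP xJ.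
(* The base is [s ^ (-4)], and injectivity of [exprz s] keeps its positive powers away from 1. *)
have q0 m : qint (c ^- 2) m.+1 != 0.
  apply: qint_neq0.
  have -> : c ^- 2 ^+ m.+1 = s ^ (- (2 * 2 * m.+1)%N%:Z).
    by rewrite exprVn -!exprM -invr_expz.
  by rewrite -(expr0z s) (inj_eq s_inj); lia.
have xC := jackson_eq0 q0 xJ.
exists (component_poly c d e x)`_0 => //; rewrite -polyC_eq0 -xC.
move=> x0; move: xK; rewrite -qpiZ => /qpiP /(component_poly_qeq c_neq0 d e).
rewrite component_poly_Kf /component_poly flin_scale -/(component_poly _ _ _ _) => /eqP.
rewrite -subr_eq0 -scalerBl scaler_eq0 (negPf x0) orbF subr_eq0 (inj_eq s_inj).
by move=> /eqP; lia.
Qed.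

(** Both conditions become vanishing of evaluations linear in [x], which can be checked on
    summands. *)
Lemma hol_lin n x : hol n x <->
  flin (fun w => s ^ wtw w *: word w - s ^ (- n%:Z) *: word w) x = 0 /\
  flin (fun w => s ^ wtw w *: qpi rels (Fw w)) x = 0.
Proof.
rewrite /hol !qpi_flin flin_Ff !flin_Kf.
have -> : flin (fun w => s ^ wtw w *: word w - s ^ (- n%:Z) *: word w) x =
    flin (fun w => s ^ wtw w *: word w) x - s ^ (- n%:Z) *: flin word x.
  rewrite /flin scaler_sumr -sumrB; apply: eq_bigr => p _.
  by rewrite scalerBr !scalerA [p.1 * s ^ (- _)]mulrC.
have -> : flin (fun w => s ^ wtw w *: qpi rels (Fw w)) x =
          flin (fun w => s ^ wtw w *: flin word (Fw w)) x.
  by apply: eq_flin => w; rewrite qpi_flin.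
split=> -[E ->]; first by rewrite E subrr.
by split=> //; apply/eqP; rewrite -subr_eq0 E.
Qed.

Lemma hol_flatten n (I : eqType) (f : I -> fsum F gen) (t : seq I) :
  {in t, forall i, hol n (f i)} -> hol n (flatten [seq f i | i <- t]).
Proof.
move=> th; apply/hol_lin; rewrite !flin_flatten !big_map !big_seq.
by rewrite !big1 // => i /th/hol_lin[].
Qed.

Lemma hol_nil n : hol n [::].
Proof. by rewrite /hol qpi0 scaler0. Qed.

Lemma holE n x : hol n x <->
  qeq rels (Kf x) (fscale (s ^ (- n%:Z)) x) /\
  qeq rels (fscale s^-1 (Ff (Kf x))) [::].
Proof.
rewrite /hol -!qpiP !qpiZ qpi0; split=> -[-> E]; split=> //; first by rewrite E scaler0.
by rewrite -[LHS]scale1r -(mulfV s_neq0) -scalerA E scaler0.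
Qed.

Lemma wtw_cat u v : wtw (u ++ v) = wtw u + wtw v.
Proof. by rewrite /wtw big_cat. Qed.

(* Twisted Leibniz rule: Delta F = F (x) K + K^-1 (x) F. *)
Lemma qpi_Fw_cat u v : qpi rels (Fw (u ++ v)) =
  s ^ wtw v *: (qpi rels (Fw u) * word v) + s ^ (- wtw u) *: (word u * qpi rels (Fw v)).
Proof.
have pi_cons g w : qpi rels (Fw (g :: w)) =
    s ^ wtw w *: (qpi rels (FgenF s g) * word w)
    + s ^ (- wt g) *: (word [:: g] * qpi rels (Fw w)).
  rewrite !qpi_flin Fw_cons -[_ ++ _]/(fadd _ _) flin_add /flin !big_map.
  rewrite mulr_suml mulr_sumr !scaler_sumr; congr (_ + _); apply: eq_bigr => p _ /=.
    by rewrite qword_cat -qscalerAl scalerA mulrC.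
  by rewrite qword_cons -qscalerAr scalerA.
elim: u => [|g u IH] /=.
  rewrite Fw_nil qpi0 mul0r scaler0 add0r qword_nil mul1r /wtw big_nil oppr0.
  by rewrite expr0z scale1r.
rewrite !pi_cons IH qword_cat (qword_cons _ g u) wtw_cat.
have -> : wtw (g :: u) = wt g + wtw u by rewrite /wtw big_cons.
rewrite opprD !expfzDr // mulrDr mulrDl !scalerDr -!qscalerAr -!qscalerAl !scalerA.
by rewrite !mulrA addrA [s ^ wtw u * _]mulrC [s ^ wtw v * s ^ (- _)]mulrC.
Qed.

Lemma holM n m x y : hol n x -> hol m y -> hol (n + m) (fmul x y).
Proof.
move=> [xK xF] [yK yF]; rewrite /hol !qpi_flin.
have KM : flin word (Kf (fmul x y)) = flin word (Kf x) * flin word (Kf y).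
  rewrite !flin_Kf qmul_flin /flin big_allpairs_dep; apply: eq_bigr => p _.
  apply: eq_bigr => r _ /=.
  rewrite qword_cat wtw_cat expfzDr // -qscalerAl -qscalerAr !scalerA.
  by rewrite !mulrA.
rewrite KM -!qpi_flin xK yK qpiM -qscalerAl -qscalerAr scalerA -expfzDr //.
split; first by rewrite PoszD opprD.
move: xF yF; rewrite !qpi_flin !flin_Ff !flin_Kf => xF yF.
(* This is [FK(xy) = (FK x)(K^2 y) + x (FK y)]: the [K^-1] of the coproduct cancels [K] on [x], so
   each term has a vanishing factor. *)
have -> : flin (fun w => s ^ wtw w *: flin word (Fw w)) (fmul x y) =
    flin (fun w => s ^ wtw w *: flin word (Fw w)) x *
      flin (fun w => (s ^ wtw w * s ^ wtw w) *: word w) y +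
    flin word x * flin (fun w => s ^ wtw w *: flin word (Fw w)) y.
  rewrite !qmul_flin -big_split /flin big_allpairs_dep; apply: eq_bigr => p _.
  rewrite -big_split; apply: eq_bigr => r _.
  rewrite /= -!/(flin word _) -!qpi_flin qpi_Fw_cat wtw_cat expfzDr // -scalerDr.
  rewrite -!qscalerAl -!qscalerAr scalerDr !scalerA -invr_expz -mulrA.
  rewrite scalerDr !scalerA -!mulrA.
  by rewrite [s ^ wtw r.2 / _]mulrC mulVKf ?expfz_neq0.
by rewrite xF yF mul0r mulr0 addr0.
Qed.

(** * Comparison with the quantum plane, degree by degree *)

Definition qgen_gen (g : qgen) : gen := match g with Qa => Ga | Qc => Gc end.
Definition emb (x : fsum F qgen) : fsum F gen :=
  [seq (p.1, map qgen_gen p.2) | p <- x].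
Definition homog n (x : fsum F qgen) : fsum F qgen := [seq p <- x | size p.2 == n].

Lemma homog_eq0 n (x : fsum F qgen) :
  all (fun p => size p.2 != n) x -> homog n x = [::].
Proof.
move=> /allP xn; rewrite -(filter_pred0 x).
by apply: eq_in_filter => p /xn/negPf.
Qed.

Lemma homog_gt n (x : fsum F qgen) :
  (\max_(p <- x) size p.2 < n)%N -> homog n x = [::].
Proof.
move=> nx; apply/homog_eq0/allP => p px; rewrite neq_ltn.
by rewrite (leq_ltn_trans (@leq_bigmax_seq _ x xpredT (fun r => size r.2) p px isT) nx).
Qed.

Lemma hol_emb n (y : fsum F qgen) : all (fun p => size p.2 == n) y -> hol n (emb y).
Proof.
move=> /allP yn; apply/hol_lin; rewrite /flin !big_map !big_seq.
have Fw0 w : Fw (map qgen_gen w) = [::].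
  by elim: w => //= g w IH; rewrite Fw_cons IH; case: g.
have wt0 w : wtw (map qgen_gen w) = - (size w)%:Z.
  elim: w => [|g w IH]; first by rewrite /wtw big_nil.
  rewrite /wtw big_cons -/(wtw _) IH -[size (g :: w)]/((size w).+1) intS opprD.
  by case: g.
split; rewrite big1 // => p /yn /eqP pn /=.
  by rewrite wt0 pn subrr scaler0.
by rewrite Fw0 qpi0 !scaler0.
Qed.

(** Each bihomogeneous component of [x] is zero or a multiple of [a^d c^e] with [d + e = n], and the
    latter is the image of a word of length [n]. *)
Lemma hol_surj n x : hol n x ->
  exists2 y, all (fun p => size p.2 == n) y & qpi rels (emb y) = qpi rels x.
Proof.
move=> xh; rewrite sum_homogeneous.
apply: (big_ind (fun z => exists2 y : fsum F qgen,
  all (fun p => size p.2 == n) y & qpi rels (emb y) = z)).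
- by exists [::].
- move=> z1 z2 [y1 a1 <-] [y2 a2 <-]; exists (y1 ++ y2).
    by rewrite all_cat a1.
  by rewrite /emb map_cat -[_ ++ _]/(fadd _ _) qpiD.
move=> [d e] _ /=; have [k Ek kn] := hol_component_poly d e xh.
have [->|[d0 e0 k0 ->]] := component_polyC c_neq0 Ek; first by exists [::].
exists [:: (k, nseq `|d|%N Qa ++ nseq `|e|%N Qc)].
  rewrite /= andbT size_cat !size_nseq; have := kn k0; lia.
rewrite qpi_flin flin_cons flin_nil addr0 /= map_cat !map_nseq qword_cat.
have word_nseq g i : word (nseq i g) = word [:: g] ^+ i.
  elim: i => [|i IH]; first by rewrite (expr0 (word _)).
  by rewrite -[nseq i.+1 g]/(g :: nseq i g) (qword_cons _ _ (nseq i g)) IH (exprS (word _)).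
rewrite !word_nseq /mon (expr0 (word _)) mulr1.
have -> : apow c d = word [:: Ga] ^+ absz d by case: d d0 {Ek kn}.
by [].
Qed.

Lemma flin_emb_homog (V : lmodType F) (G : seq gen -> V) n (x : fsum F qgen) :
  flin G (emb (homog n x)) =
  flin (fun w => if size w == n then G (map qgen_gen w) else 0) x.
Proof.
rewrite /flin big_map big_filter big_mkcond; apply: eq_bigr => p _.
by case: eqP => _ /=; rewrite ?scaler0.
Qed.

Definition qplane_relsF : seq (fsum F qgen) :=
  [:: [:: (1, [:: Qa; Qc]); (- c, [:: Qc; Qa])]].
Local Notation qw := (qword qplane_relsF).

Lemma emb_qeq n (x y : fsum F qgen) : qeq qplane_relsF x y ->
  qpi rels (emb (homog n x)) = qpi rels (emb (homog n y)).
Proof.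
rewrite !qpi_flin !flin_emb_homog; apply: flin_qeq => u v r.
rewrite inE => /eqP ->; rewrite !flin_cons flin_nil !size_cat /=.
case: eqP => _; last by rewrite !scaler0 !addr0.
rewrite addr0 !map_cat !(qword_cat _ (map _ u)) /=.
have acE w : word [:: Ga, Gc & w] = c *: word [:: Gc, Ga & w].
  rewrite (qword_cat _ [:: Ga; Gc] w) (qword_cat _ [:: Gc; Ga] w) qscalerAl.
  by rewrite (@qword_eq2 _ _ _ c [:: Ga; Gc] [:: Gc; Ga]) // !inE eqxx.
by rewrite acE scale1r -qscalerAr scaleNr subrr.
Qed.

Lemma dega_emb w : dega (map qgen_gen w) = (count_mem Qa w)%:Z.
Proof.
elim: w => [|g w IH]; first by rewrite /= dega_nil.
by rewrite map_cons dega_cons IH; case: g.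
Qed.

Lemma degc_emb w : degc (map qgen_gen w) = (count_mem Qc w)%:Z.
Proof.
elim: w => [|g w IH]; first by rewrite /= degc_nil.
by rewrite map_cons degc_cons IH; case: g.
Qed.

Lemma size_qgen w : size w = (count_mem Qa w + count_mem Qc w)%N.
Proof. by elim: w => //= -[] w ->; rewrite ?addSn ?addnS. Qed.

(** The scalar produced by sorting a word of the quantum plane is the one that the model assigns to
    its image; this agreement underlies injectivity. *)
Lemma qplane_word w : qw w = (word_poly c (map qgen_gen w) 0)`_0 *:
  (qw [:: Qa] ^+ count_mem Qa w * qw [:: Qc] ^+ count_mem Qc w).
Proof.
elim: w => [|g w IH]; first by rewrite /= coef1 scale1r mulr1.
rewrite qword_cons IH -qscalerAr /= addr0 dega_emb.
case: g => /=; first by rewrite mul1r mulrA -(exprS (qw _)).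
rewrite coefCM -scalerA mulrA.
have ca : qw [:: Qc] * qw [:: Qa] = c^-1 *: (qw [:: Qa] * qw [:: Qc]).
  rewrite -!qword_cat (@qword_eq2 _ _ _ c [:: Qa; Qc] [:: Qc; Qa]) ?inE //.
  by rewrite scalerA mulVf // scale1r.
rewrite (qcommX _ ca) -qscalerAl -mulrA -(exprS (qw _)) scalerA scalerA mulrC.
by rewrite exprVn -exprnN.
Qed.

Lemma emb_inj (x : fsum F qgen) :
  (forall n, qpi rels (emb (homog n x)) = 0) -> qpi qplane_relsF x = 0.
Proof.
move=> x0.
pose ty (w : seq qgen) := (count_mem Qa w, count_mem Qc w).
pose S := undup [seq ty p.2 | p <- x].
(* The words with [i] letters [Qa] and [j] letters [Qc] all have length [i + j], so the component of
   bidegree [(i, j)] is read off from that homogeneous part. *)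
have x0c (i j : nat) : flin (fun w => if ty w == (i, j)
    then word_poly c (map qgen_gen w) 0 else 0) x = 0.
  have := component_poly_qeq c_neq0 i j
    ((qpiP _ _ _).1 (x0 (i + j)%N : _ = qpi rels [::])).
  rewrite {2}/component_poly flin_nil /component_poly flin_emb_homog.
  apply: etrans; apply: eq_flin => w.
  rewrite /bideg dega_emb degc_emb size_qgen /ty !xpair_eqE !eqz_nat.
  case: eqP => [->|_] /=; last by rewrite if_same.
  by case: eqP => [->|_]; rewrite ?eqxx ?if_same.
have -> : qpi qplane_relsF x = \sum_(D <- S) (flin (fun w => if ty w == D
    then word_poly c (map qgen_gen w) 0 else 0) x)`_0 *:
    (qw [:: Qa] ^+ D.1 * qw [:: Qc] ^+ D.2).
  rewrite qpi_flin /flin.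
  under [RHS]eq_bigr do rewrite coef_sum scaler_suml.
  rewrite exchange_big /= [LHS]big_seq [RHS]big_seq; apply: eq_bigr => p px.
  have pD : ty p.2 \in [seq ty r.2 | r <- x] by apply/mapP; exists p.
  rewrite (bigD1_seq (ty p.2)) ?undup_uniq ?mem_undup //=.
  rewrite eqxx coefZ -scalerA -qplane_word big1 ?addr0 // => D /negPf.
  by rewrite eq_sym => ->; rewrite scaler0 coef0 scale0r.
by rewrite big1 // => -[i j] _; rewrite x0c coef0 scale0r.
Qed.

End HolomorphicSections.

(** * The graded isomorphism *)

Section GradedIsomorphism.
Variables (R : realType) (q : R).
Hypotheses (hq0 : 0 < q) (hq1 : q < 1).
Local Notation C := (R[i]).
Local Notation s := (sq q).
Local Notation c := (s ^+ 2).
Local Notation rels := (suq2_relsF c).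
Local Notation hol := (hol s (Fword q)).
Implicit Types (x y : fsum C qgen) (r t : seq (fsum C gen)) (n : nat).

Lemma real_complex_sq : real_complex R q = c.
Proof. by rewrite /sq -rmorphXn /= sqr_sqrtr // ltW. Qed.

Lemma sq_neq0 : s != 0.
Proof. by rewrite fmorph_eq0 gt_eqF // sqrtr_gt0. Qed.

Lemma sq_exprz_inj : injective (exprz s).
Proof.
move=> i j; rewrite /sq -!fmorphXz => /fmorph_inj.
apply: ieexprIz; rewrite ?sqrtr_gt0 //.
by rewrite lt_eqF // -sqrtr1 ltr_sqrt.
Qed.

Lemma eqAE (x y : fsum C gen) : eqA q x y <-> qpi rels x = qpi rels y.
Proof. by rewrite qpiP -real_complex_sq. Qed.

Lemma eqQE x y :
  eqQ q x y <-> qpi (qplane_relsF s) x = qpi (qplane_relsF s) y.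
Proof. by rewrite qpiP /qplane_relsF -real_complex_sq. Qed.

Lemma Fword_nil : Fword q [::] = [::]. Proof. by []. Qed.

Lemma Fword_cons g w : Fword q (g :: w) =
  [seq (p.1 * s ^ wtw w, p.2 ++ w) | p <- FgenF s g]
  ++ [seq (s ^ (- wt g) * p.1, g :: p.2) | p <- Fword q w].
Proof. by rewrite /FgenF -real_complex_sq. Qed.

Lemma H0E n (x : fsum C gen) : H0 q n x <-> hol n x.
Proof. by rewrite (holE sq_neq0) -real_complex_sq. Qed.

Lemma isR_Rmul r t : isR q r -> isR q t -> isR q (Rmul r t).
Proof.
move=> hr ht n; apply/H0E.
have [nl|nl] := ltnP n (size r + size t); last first.
  by rewrite /Rcomp nth_default ?size_mkseq //; exact: hol_nil.
rewrite /Rcomp nth_mkseq //; apply: hol_flatten => i.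
rewrite mem_iota /= add0n ltnS => ni.
rewrite -[n in hol n](subnKC ni).
by apply: (holM sq_neq0 Fword_nil Fword_cons); apply/H0E.
Qed.

Lemma qpi_Rmul r t n : qpi rels (Rcomp (Rmul r t) n) =
  \sum_(i < n.+1) qpi rels (Rcomp r i) * qpi rels (Rcomp t (n - i)).
Proof.
have pi0 u i : (size u <= i)%N -> qpi rels (Rcomp u i) = 0.
  by move=> ui; rewrite /Rcomp nth_default.
have [nl|nl] := ltnP n (size r + size t); last first.
  (* For [n] beyond the truncation each product has a factor past the end of its list, hence
     zero. *)
  rewrite {1}/Rcomp nth_default ?size_mkseq // qpi0 big1 // => i _.
  have [ri|ri] := leqP (size r) i; first by rewrite pi0 ?mul0r.
  have ti : (size t <= n - i)%N.
    rewrite leq_subRL; last by rewrite -ltnS.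
    by apply: leq_trans nl; rewrite leq_add2r ltnW.
  by rewrite [X in _ * X]pi0 ?mulr0.
rewrite {1}/Rcomp nth_mkseq // qpi_flin flin_flatten big_map.
rewrite -[n.+1]subn0 -/(index_iota 0 n.+1) big_mkord.
by apply: eq_bigr => i _; rewrite -qpi_flin qpiM.
Qed.

(** The isomorphism onto R. The list stops at the length of the longest word, after which all
    homogeneous parts are empty. *)
Definition graded_pieces x : seq (fsum C gen) :=
  mkseq (fun n => emb (homog n x)) (\max_(p <- x) size p.2).+1.

Lemma Rcomp_graded_pieces x n : Rcomp (graded_pieces x) n = emb (homog n x).
Proof.
have [nl|nl] := ltnP n (\max_(p <- x) size p.2).+1; rewrite /Rcomp.
  by rewrite nth_mkseq.
by rewrite nth_default ?size_mkseq // homog_gt.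
Qed.

Lemma isR_graded_pieces x : isR q (graded_pieces x).
Proof.
move=> n; apply/H0E; rewrite Rcomp_graded_pieces.
by apply: (hol_emb Fword_nil Fword_cons); apply: filter_all.
Qed.

Lemma eqR_graded_pieces x r : eqR q (graded_pieces x) r <->
  forall n, qpi rels (emb (homog n x)) = qpi rels (Rcomp r n).
Proof.
split=> E n; last by apply/eqAE; rewrite Rcomp_graded_pieces E.
by rewrite -Rcomp_graded_pieces; apply/eqAE/E.
Qed.

Lemma graded_pieces_inj x y : eqR q (graded_pieces x) (graded_pieces y) -> eqQ q x y.
Proof.
move=> /eqR_graded_pieces E; apply/eqQE/eqP; rewrite -subr_eq0; apply/eqP.
have -> : qpi (qplane_relsF s) x - qpi (qplane_relsF s) y =
          qpi (qplane_relsF s) (fsub x y) by rewrite qpiD qpiZ scaleN1r.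
apply: (emb_inj sq_neq0) => n.
rewrite qpi_flin flin_emb_homog flin_sub -!flin_emb_homog -!qpi_flin E.
rewrite Rcomp_graded_pieces.
by rewrite subrr.
Qed.

Lemma graded_pieces_surj r : isR q r -> exists x, eqR q (graded_pieces x) r.
Proof.
move=> hr.
(* Preimages of the components are added one degree at a time; the length bound ensures that the new
   words, of length exactly [m], leave the lower degrees unchanged. *)
have step m : exists2 x : fsum C qgen, all (fun p => size p.2 < m)%N x &
    forall n, (n < m)%N -> qpi rels (emb (homog n x)) = qpi rels (Rcomp r n).
  elim: m => [|m [x xm xE]]; first by exists [::].
  have /H0E hm := hr m.
  have [y ym yE] := hol_surj sq_neq0 sq_exprz_inj Fword_nil Fword_cons hm.
  exists (x ++ y).
    rewrite all_cat; apply/andP; split.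
      by apply: sub_all xm => p /ltnW.
    by apply: sub_all ym => p /eqP->.
  move=> n; rewrite ltnS leq_eqVlt /homog filter_cat => /orP[/eqP->|nm].
    have -> : [seq p <- x | size p.2 == m] = [::].
      by apply: homog_eq0; apply: sub_all xm => p; rewrite neq_ltn => ->.
    by have /all_filterP-> := ym.
  have -> : [seq p <- y | size p.2 == n] = [::].
    by apply: homog_eq0; apply: sub_all ym => p /eqP->; rewrite gtn_eqF.
  by rewrite cats0 xE.
have [x xm xE] := step (size r); exists x; apply/eqR_graded_pieces => n.
have [|rn] := ltnP n (size r); first exact: xE.
rewrite /Rcomp nth_default // homog_eq0 //; apply: sub_all xm => p pr.
by rewrite neq_ltn (leq_trans pr).
Qed.

Lemma graded_piecesD x y :
  eqR q (graded_pieces (fadd x y)) (Radd (graded_pieces x) (graded_pieces y)).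
Proof.
apply/eqR_graded_pieces => n.
have -> : emb (homog n (fadd x y)) =
    fadd (Rcomp (graded_pieces x) n) (Rcomp (graded_pieces y) n).
  by rewrite !Rcomp_graded_pieces /emb /homog filter_cat map_cat.
rewrite /Radd.
have [nl|] := ltnP n (maxn (size (graded_pieces x)) (size (graded_pieces y))).
  by rewrite [in RHS]/Rcomp nth_mkseq.
rewrite geq_max => /andP[xn yn].
by rewrite /Rcomp !nth_default // size_mkseq geq_max xn.
Qed.

Lemma graded_piecesM x y :
  eqR q (graded_pieces (fmul x y)) (Rmul (graded_pieces x) (graded_pieces y)).
Proof.
apply/eqR_graded_pieces => n; rewrite qpi_Rmul.
pose G n w := if size w == n then qword rels (map qgen_gen w) else 0.
have piG i z : qpi rels (emb (homog i z)) = flin (G i) z.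
  by rewrite qpi_flin flin_emb_homog.
under eq_bigr do rewrite !Rcomp_graded_pieces !piG qmul_flin.
rewrite piG exchange_big /flin big_allpairs_dep; apply: eq_bigr => p _.
rewrite exchange_big; apply: eq_bigr => r _ /=; rewrite -scaler_sumr.
(* Only the index [i = size p.2] can contribute to the convolution. *)
suff -> : G n (p.2 ++ r.2) = \sum_(i < n.+1) G i p.2 * G (n - i)%N r.2 by [].
rewrite /G size_cat; case: eqP => [<-|ne].
  have pl : (size p.2 < (size p.2 + size r.2).+1)%N by rewrite ltnS leq_addr.
  rewrite (bigD1 (Ordinal pl)) //= eqxx addKn eqxx big1 => [|i].
    by rewrite addr0 map_cat qword_cat.
  by rewrite -val_eqE /= eq_sym => /negPf->; rewrite mul0r.
rewrite big1 // => i _; case: eqP => [pi|]; last by rewrite mul0r.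
by case: eqP => [rn|]; rewrite ?mulr0 //; case: ne; rewrite pi rn subnKC // -ltnS.
Qed.

End GradedIsomorphism.

Theorem theorem4p5 (R : realType) (q : R) (hq0 : 0 < q) (hq1 : q < 1) :
  (* R is closed under the product induced by A(SU_q(2)) (ring structure) *)
  (forall r s, isR q r -> isR q s -> isR q (Rmul r s)) /\
  isR q (Rone R) /\
  (* and is isomorphic as a ring to the quantum plane C<a,c>/(ac - q ca) *)
  exists phi : fsum R[i] qgen -> seq (fsum R[i] gen),
    (forall x, isR q (phi x)) /\
    (forall x y, eqQ q x y -> eqR q (phi x) (phi y)) /\
    (forall x y, eqR q (phi x) (phi y) -> eqQ q x y) /\
    (forall r, isR q r -> exists x, eqR q (phi x) r) /\
    (forall x y, eqR q (phi (fadd x y)) (Radd (phi x) (phi y))) /\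
    (forall x y, eqR q (phi (fmul x y)) (Rmul (phi x) (phi y))) /\
    eqR q (phi (fone R[i] qgen)) (Rone R).
Proof.
(* The only word of [fone] is empty, so the list has length one and the equality holds literally. *)
have one : graded_pieces (fone R[i] qgen) = Rone R.
  by rewrite /graded_pieces big_seq1.
split; first exact: isR_Rmul hq0.
split; first by rewrite -one; apply: isR_graded_pieces hq0 _.
exists (@graded_pieces R); split; first exact: isR_graded_pieces hq0.
split.
  move=> x y /(eqQE hq0)/qpiP xy; apply/(eqR_graded_pieces hq0) => n.
  by rewrite Rcomp_graded_pieces; exact: emb_qeq.
split; first exact: graded_pieces_inj hq0.
split; first exact: graded_pieces_surj hq0 hq1.
split; first exact: graded_piecesD hq0.
split; first exact: graded_piecesM hq0.
by rewrite one => n; apply/(eqAE hq0).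
Qed.
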